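(* Suppose that the following four assumptions hold. (1) There exists a constant $0<F_{\max}<\infty$ such that $|f_d(\theta)|\le F_{\max}$ for any $d\in D$ and any $\theta$. (2) There exists a constant $c_0>0$ such that for all $0<r<1$, $$\mathbb{P}_Y\Big[\min_{y\in K}\|Y-y\|\le r\Big]\le c_0 r.$$ (3) There exist constants $c_1,c_2>0$ such that if $Y\notin K$, then $$\max_{d\in D}G_d(Y)-\max_{\substack{d\in D\\ d\ne d_{\mathrm{opt}}(Y)}}G_d(Y)>\min\Big(c_1,\;c_2\min_{y\in K}\|Y-y\|\Big).$$ (4) There exists a constant $p\ge 2$ such that $$\mathbb{E}_Y\left[\mathbb{E}_\theta\left[\left(\frac{\rho(Y\,|\,\theta)}{\rho(Y)}\right)^p\right]\right]<\infty.$$ Then, with $p$ as in (4), the antithetic multilevel correction variables $\Delta P_\ell$ satisfy, as $\ell\to\infty$, $$\mathbb{V}[\Delta P_\ell]=O\big(2^{-(3p/(2p+2))\ell}\big)\qquad\text{and}\qquad \mathbb{E}[|\Delta P_\ell|]=O\big(2^{-(p/(p+1))\ell}\big),$$ where the implied constants do not depend on $\ell$.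
   Context: Setting. $\theta$ is a random vector with (prior) probability density $\pi_0$; $\mathbb{E}_\theta$ denotes expectation with respect to $\pi_0$. $D$ is a finite set of decisions, and for each $d\in D$, $f_d$ is a real-valued function of $\theta$. The random vector $Y$ is generated by $Y=h(\theta)+\epsilon$, where $h$ is a known deterministic (possibly vector-valued) function and $\epsilon$ is a zero-mean random noise variable with density $\rho$, independent of $\theta$; thus the conditional density (likelihood) of $Y$ given $\theta$ is $\rho(Y\,|\,\theta):=\rho(Y-h(\theta))$. $\mathbb{E}_Y$ and $\mathbb{P}_Y$ refer to the marginal distribution of $Y$, whose density is $\rho(Y):=\mathbb{E}_\theta[\rho(Y\,|\,\theta)]$. In an expression such as $\mathbb{E}_Y[\mathbb{E}_\theta[\cdot]]$ the inner expectation is over the prior of $\theta$ with $Y$ held fixed (i.e. $\theta$ is drawn from the prior independently of $Y$). Put $F_d(Y):=\mathbb{E}_\theta[f_d(\theta)\rho(Y\,|\,\theta)]$ and $G_d(Y):=F_d(Y)/\rho(Y)$ (the posterior expectation of $f_d(\theta)$ given $Y$), and $d_{\mathrm{opt}}(Y):=\arg\max_{d\in D}F_d(Y)=\arg\max_{d\in D}G_d(Y)$. $K$ denotes the set of values of $Y$ at which $d_{\mathrm{opt}}$ is not uniquely defined (the decision manifold); it is assumed to be a lower-dimensional subspace of the domain for $Y$. $\|\cdot\|$ is the norm on the space of $Y$. $\mathbb{V}$ denotes variance. Correction variables. Fix $M_0\in\mathbb{Z}_{>0}$ and set $M_\ell=M_02^\ell$. For $\ell\ge 1$, draw $Y$ from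 its marginal distribution and, independently of $Y$, i.i.d. samples $\theta^{(1)},\dots,\theta^{(M_\ell)}$ from $\pi_0$. For a function $\varphi$ of $\theta$ write $\overline{\varphi}=\frac1{M_\ell}\sum_{m=1}^{M_\ell}\varphi(\theta^{(m)})$, and let $\overline{\varphi}^{(a)}$ and $\overline{\varphi}^{(b)}$ be the averages of $\varphi$ over the first $M_{\ell-1}$ samples and over the remaining $M_{\ell-1}$ samples, respectively. Define $$\overline{g_d}=\frac{\overline{f_d(\cdot)\rho(Y\,|\,\cdot)}}{\overline{\rho(Y\,|\,\cdot)}},\qquad \overline{g}_{\max}=\frac{\overline{\max_{d\in D}f_d(\cdot)\,\rho(Y\,|\,\cdot)}}{\overline{\rho(Y\,|\,\cdot)}},$$ and define $\overline{g_d}^{(a)},\overline{g}_{\max}^{(a)}$ (resp. $\overline{g_d}^{(b)},\overline{g}_{\max}^{(b)}$) by the same ratios with all averages, in numerator and denominator, replaced by the $(a)$ (resp. $(b)$) averages. Ratios are read with the convention $0/0=0$. Then for $\ell\ge1$ $$\Delta P_\ell=\overline{g}_{\max}-\max_{d\in D}\overline{g_d}-\frac12\left[\overline{g}_{\max}^{(a)}+\overline{g}_{\max}^{(b)}\right]+\frac12\left[\max_{d\in D}\overline{g_d}^{(a)}+\max_{d\in D}\overline{g_d}^{(b)}\right].$$ *)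

(* Defs.v *)
From HB Require Import structures.
From mathcomp Require Import all_boot all_order all_algebra.
From mathcomp Require Import all_classical all_reals all_analysis.

Set Implicit Arguments.
Unset Strict Implicit.
Unset Printing Implicit Defensive.

Import Order.TTheory GRing.Theory Num.Theory.
Import numFieldNormedType.Exports.

Local Open Scope classical_set_scope.
Local Open Scope ring_scope.

(* R^n is 'rV[R]_n with the product (Borel) sigma-algebra, generated by the
   coordinates as the library does for n.-tuple T. *)
Definition rV_display : measure_display. Proof. by constructor. Qed.

Section measurable_rV.
Context {R : realType} {n : nat}.

Definition rV_coord (i : 'I_n) (v : 'rV[R]_n) : R := v ord0 i.

Let rV_set0 : g_sigma_preimage rV_coord set0.
Proof. exact: sigma_algebra0. Qed.

Let rV_setC A : g_sigma_preimage rV_coord A -> g_sigma_preimage rV_coord (~` A).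
Proof. exact: sigma_algebraC. Qed.

Let rV_bigcup (F : (set 'rV[R]_n)^nat) :
  (forall i, g_sigma_preimage rV_coord (F i)) ->
  g_sigma_preimage rV_coord (\bigcup_i (F i)).
Proof. exact: sigma_algebra_bigcup. Qed.

HB.instance Definition _ := @isMeasurable.Build rV_display 'rV[R]_n
  (g_sigma_preimage rV_coord) rV_set0 rV_setC rV_bigcup.

Lemma measurable_rV_coord (i : 'I_n) : measurable_fun [set: 'rV[R]_n] (rV_coord i).
Proof.
move=> _ Y mY; rewrite setTI; apply: sub_sigma_algebra => /=.
rewrite -bigcup_seq/=; exists i => /=; first by rewrite mem_index_enum.
by exists Y => //; rewrite setTI.
Qed.

Lemma measurable_fun_rV d (T : measurableType d) (f : T -> 'rV[R]_n) :
  (forall i, measurable_fun [set: T] (rV_coord i \o f)) ->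
  measurable_fun [set: T] f.
Proof.
move=> mf _ A mA; rewrite setTI.
have : preimage_set_system [set: T] f (g_sigma_preimage rV_coord) `<=` measurable.
  rewrite -g_sigma_preimageE; apply: smallest_sub.
    exact: sigma_algebra_measurable.
  move=> B [C + <-]; rewrite -bigcup_seq/= => -[i _ [D mD <-]].
  by rewrite !setTI; have := mf i measurableT D mD; rewrite setTI.
by apply; exists A => //; rewrite setTI.
Qed.

End measurable_rV.

Section lebesgue_rV_step.
Context {R : realType} {n : nat}.
Variable mu : {sigma_finite_measure set 'rV[R]_n -> \bar R}.

Definition rV_cons (xv : measurableTypeR R * 'rV[R]_n) : 'rV[R]_n.+1 :=
  \row_i (if unlift ord0 i is Some j then xv.2 ord0 j else xv.1).

Lemma rV_cons0 xv : rV_cons xv ord0 ord0 = xv.1.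
Proof. by rewrite mxE unlift_none. Qed.

Lemma rV_consS xv i : rV_cons xv ord0 (lift ord0 i) = xv.2 ord0 i.
Proof. by rewrite mxE liftK. Qed.

Lemma measurable_rV_cons : measurable_fun setT rV_cons.
Proof.
apply: measurable_fun_rV => i; have [j ->|->] := unliftP ord0 i.
  rewrite (_ : _ \o _ = rV_coord j \o snd).
    exact: measurableT_comp (measurable_rV_coord j) measurable_snd.
  by apply/funext => xv /=; rewrite /rV_coord rV_consS.
rewrite (_ : _ \o _ = fst); first exact: measurable_fst.
by apply/funext => xv /=; rewrite /rV_coord rV_cons0.
Qed.

Definition lebesgue_rV_step : set 'rV[R]_n.+1 -> \bar R :=
  pushforward (lebesgue_measure \x mu)%E rV_cons.

HB.instance Definition _ := Measure.copy lebesgue_rV_step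
  (measure_function_pushforward__canonical__measure_function_Measure
    (lebesgue_measure \x mu)%E measurable_rV_cons).

Lemma lebesgue_rV_step_sigma_finite : sigma_finite setT lebesgue_rV_step.
Proof.
pose uncons (v : 'rV[R]_n.+1) : measurableTypeR R * 'rV[R]_n :=
  (v ord0 ord0, \row_i v ord0 (lift ord0 i)).
have unconsK xv : uncons (rV_cons xv) = xv.
  case: xv => x v; congr pair; first by rewrite rV_cons0.
  by apply/rowP => i; rewrite mxE rV_consS.
have muncons : measurable_fun setT uncons.
  apply/measurable_fun_pairP; split; first exact: measurable_rV_coord.
  apply: measurable_fun_rV => i.
  rewrite (_ : _ \o _ = rV_coord (lift ord0 i)); first exact: measurable_rV_coord.
  by apply/funext => v /=; rewrite /rV_coord mxE.
pose leb : {sigma_finite_measure set (measurableTypeR R) -> \bar R} :=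
  lebesgue_measure.
have /sigma_finiteP[F [TF ndF Foo]] := sigma_finiteT leb.
have /sigma_finiteP[G [TG ndG Goo]] := sigma_finiteT mu.
exists (fun k => uncons @^-1` (F k `*` G k)).
  rewrite -preimage_bigcup (_ : \bigcup_k _ = setT) ?preimage_setT//.
  apply/seteqP; split => // -[x v] _.
  have [i _ Fx] : (\bigcup_i F i) x by rewrite -TF.
  have [j _ Gv] : (\bigcup_i G i) v by rewrite -TG.
  exists (maxn i j) => //; split.
    by move: x Fx; exact/subsetPset/ndF/leq_maxl.
  by move: v Gv; exact/subsetPset/ndG/leq_maxr.
move=> k; have [mF Fk] := Foo k; have [mG Gk] := Goo k; split.
  by rewrite -[X in measurable X]setTI; apply: muncons => //; exact: measurableX.
rewrite /lebesgue_rV_step /pushforward -comp_preimage.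
rewrite (_ : uncons \o rV_cons = id); last exact/funext.
by rewrite preimage_id product_measure1E// lte_mul_pinfty// ge0_fin_numE.
Qed.

HB.instance Definition _ := Measure_isSigmaFinite.Build _ _ _ lebesgue_rV_step
  lebesgue_rV_step_sigma_finite.

End lebesgue_rV_step.

Fixpoint lebesgue_rV (R : realType) n :
    {sigma_finite_measure set 'rV[R]_n -> \bar R} :=
  if n is m.+1 then lebesgue_rV_step (lebesgue_rV R m) else \d_(0 : 'rV[R]_0).

Lemma lebesgue_rV_box (R : realType) n (B : 'I_n -> set (measurableTypeR R)) :
  (forall i, measurable (B i)) ->
  lebesgue_rV R n [set v | forall i, B i (v ord0 i)] =
  (\prod_(i < n) lebesgue_measure (B i))%E.
Proof.
elim: n B => [|n IH] B mB.
  rewrite big_ord0 /= diracE mem_set//= => -[].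
  by [].
rewrite big_ord_recl /= -IH; last by move=> i; exact: mB.
rewrite /lebesgue_rV_step /pushforward.
pose C := [set v : 'rV[R]_n | forall i, B (lift ord0 i) (v ord0 i)].
have mC : measurable C.
  rewrite (_ : C = \bigcap_(i in [set: 'I_n])
      (rV_coord i @^-1` (B (lift ord0 i)))).
    apply: fin_bigcap_measurable => // i _.
    rewrite -[X in measurable X]setTI.
    by apply: measurable_rV_coord => //; exact: mB.
  by apply/seteqP; split=> [v Cv i _|v Cv i]; exact: Cv.
rewrite -[RHS](product_measure1E _ _ (mB ord0) mC).
congr (_ _); apply/seteqP; split => -[x v] /=.
  move=> Bv; split=> [|i]; first by have := Bv ord0; rewrite rV_cons0.
  by have := Bv (lift ord0 i); rewrite rV_consS.
move=> [Bx Bv] i; have [j ->|->] := unliftP ord0 i.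
  by rewrite rV_consS.
by rewrite rV_cons0.
Qed.

Definition has_density d (T : measurableType d) (R : realType)
    (mu : set T -> \bar R) (law : set T -> \bar R) (g : T -> R) : Prop :=
  [/\ measurable_fun [set: T] g, (forall x, 0 <= g x) &
      forall A, measurable A -> law A = (\int[mu]_(x in A) (g x)%:E)%E].

Definition indep_pair d d1 d2 (Om : measurableType d) (T1 : measurableType d1)
    (T2 : measurableType d2) (R : realType) (P : probability Om R)
    (X : Om -> T1) (Z : Om -> T2) : Prop :=
  forall A B, measurable A -> measurable B ->
    P (X @^-1` A `&` Z @^-1` B) = (P (X @^-1` A) * P (Z @^-1` B))%E.

(* Mutual independence of X, Z_0, ..., Z_(M-1).  Subfamilies are covered by
   taking some of the sets to be the full space. *)
Definition indep_draws d d1 d2 (Om : measurableType d) (T1 : measurableType d1)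
    (T2 : measurableType d2) (R : realType) (P : probability Om R)
    (X : Om -> T1) (M : nat) (Z : nat -> Om -> T2) : Prop :=
  forall (A : set T1) (B : nat -> set T2),
    measurable A -> (forall m, measurable (B m)) ->
    P (X @^-1` A `&` \bigcap_(m in `I_M) (Z m @^-1` B m)) =
    (P (X @^-1` A) * \prod_(m < M) P (Z m @^-1` B m))%E.

Definition same_law d d' (Om : measurableType d) (T : measurableType d')
    (R : realType) (P : probability Om R) (X Z : {mfun Om >-> T}) : Prop :=
  forall A, measurable A -> distribution P X A = distribution P Z A.

Definition zero_mean d (Om : measurableType d) (R : realType) n
    (P : probability Om R) (X : Om -> 'rV[R]_n) : Prop :=
  forall i, P.-integrable [set: Om] (fun w => (X w ord0 i)%:E) /\
            ('E_P[fun w => X w ord0 i] = 0)%E.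

Definition is_norm (R : realType) (V : lmodType R) (N : V -> R) : Prop :=
  [/\ (forall x y, N (x + y) <= N x + N y),
      (forall a x, N (a *: x) = `|a| * N x) &
      (forall x, N x = 0 -> x = 0)].

(* An infimum rather than a minimum, so that no closedness of K is presupposed;
   the distance to the empty set is +oo. *)
Definition dist_to (R : realType) (V : zmodType) (N : V -> R) (K : set V)
    (y : V) : \bar R :=
  ereal_inf [set (N (y - z))%:E | z in K].

Definition max_over (R : realType) (D : finType) (d0 : D) (x : D -> R) : R :=
  \big[Num.max/x d0]_(d : D) x d.

Section model.
Context {R : realType} {s k : nat} {D : finType}.
Variables (d0 : D) (prior : probability 'rV[R]_s R).
Variables (rho : 'rV[R]_k -> R) (h : 'rV[R]_s -> 'rV[R]_k).
Variable f : D -> 'rV[R]_s -> R.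

Definition likelihood (y : 'rV[R]_k) (t : 'rV[R]_s) : R := rho (y - h t).

(* rho(y); it is 0 by convention at the (Lebesgue-negligible) y where the
   integral diverges. *)
Definition evidence (y : 'rV[R]_k) : R := fine 'E_prior[likelihood y].

Definition Fd (d : D) (y : 'rV[R]_k) : R :=
  fine 'E_prior[fun t => f d t * likelihood y t].

Definition Gd (d : D) (y : 'rV[R]_k) : R := Fd d y / evidence y.

Definition d_opt (y : 'rV[R]_k) : D := [arg max_(d > d0) Fd d y]%O.

(* The values y that Y takes: the posterior expectations G_d(y) only make sense
   where rho(y) > 0.  Where rho(y) = 0 all the F_d vanish, so without this
   restriction the complement of the support of Y would be part of K. *)
Definition Y_domain : set 'rV[R]_k := [set y | 0 < evidence y].

Definition decision_manifold : set 'rV[R]_k :=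
  [set y | Y_domain y /\ ~ exists! d, forall d', Fd d' y <= Fd d y].

(* The second maximum is -oo, hence the gap +oo, when D has a single element. *)
Definition decision_gap (y : 'rV[R]_k) : \bar R :=
  ((max_over d0 (Gd ^~ y))%:E -
   \big[maxe/-oo]_(d : D | d != d_opt y) (Gd d y)%:E)%E.

(* Average of phi over the samples th a, ..., th (b - 1). *)
Definition sample_avg (th : nat -> 'rV[R]_s) (a b : nat) (phi : 'rV[R]_s -> R) : R :=
  (b - a)%N%:R^-1 * \sum_(a <= m < b) phi (th m).

(* Division by 0 is 0, which gives the convention 0/0 = 0. *)
Definition g_avg (y : 'rV[R]_k) (th : nat -> 'rV[R]_s) (a b : nat) (d : D) : R :=
  sample_avg th a b (fun t => f d t * likelihood y t) /
  sample_avg th a b (likelihood y).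

Definition g_max_avg (y : 'rV[R]_k) (th : nat -> 'rV[R]_s) (a b : nat) : R :=
  sample_avg th a b (fun t => max_over d0 (f ^~ t) * likelihood y t) /
  sample_avg th a b (likelihood y).

Definition level_size (M0 l : nat) : nat := (M0 * 2 ^ l)%N.

(* Meaningful for 1 <= l only. *)
Definition DeltaP (M0 l : nat) (y : 'rV[R]_k) (th : nat -> 'rV[R]_s) : R :=
  let M := level_size M0 l in
  let M' := level_size M0 l.-1 in
  g_max_avg y th 0 M - max_over d0 (g_avg y th 0 M)
  - 2^-1 * (g_max_avg y th 0 M' + g_max_avg y th M' M)
  + 2^-1 * (max_over d0 (g_avg y th 0 M') + max_over d0 (g_avg y th M' M)).

End model.

(* Main.v *)
Require Import Defs.
From HB Require Import structures.
From mathcomp Require Import all_boot all_order all_algebra.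
From mathcomp Require Import all_classical all_reals all_analysis.
From mathcomp Require Import measurable_realfun ring lra.

Set Implicit Arguments.
Unset Strict Implicit.
Unset Printing Implicit Defensive.

Import Order.TTheory GRing.Theory Num.Theory.
Import numFieldNormedType.Exports.

Local Open Scope classical_set_scope.
Local Open Scope ring_scope.

(* A ratio estimator g of a posterior mean G satisfies
   g - G = (linear statistic) - (g - G) * q, where q is the centred average of
   the normalised likelihoods.  The linear part is the mean of its two antithetic
   halves, so it cancels in DeltaP and leaves a term of order e^2, where e
   bounds all the centred block averages.  This is the whole difference as long
   as the three maxima over D are attained at d_opt; otherwise DeltaP is only of
   order e, but then e dominates the decision gap at Y, hence the distance from Y
   to K.  By the Marcinkiewicz-Zygmund inequality, u = M^(1/2) e has a p-th moment
   bounded in the level, and splitting at distance r = M^(-p/(2p+2)) from K gives,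
   for q = 1, 2,
     |DeltaP|^q <= C M^(-p(q+1)/(2p+2)) (1 + u^p + 1{dist(Y,K) <= r} / r),
   whose right-hand factor has bounded expectation by the assumption on the mass
   of Y near K.  That rho(Y) > 0 almost surely follows from the density of Y,
   through the translation invariance of Lebesgue measure. *)

(** * Moments of sums of centred draws *)

(** Write r = M^(-t). Near K, interpolating between e^p and the mass of the neighbourhood gives the
    order M^(-q/2 - t(1 - q/p)); far from K, e is at least of order r and its p-th moment gives
    M^(-p/2 + t(p - q)). For q < p the two exponents agree exactly at t = p/(2p+2), which does not
    involve q, so one radius serves both claims. Only p moments of e are available and p may be less
    than 2q, so the remainder e^2 cannot simply be raised to the power q. The ratio estimators are
    bounded, which improves e^2 to e min(1, e), and the q-th power of this is controlled by the p-th
    moment alone. All summands phi(Y, theta_m) share Y and are centred only once Y is fixed. The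
    moment inequality is therefore obtained by adding one draw at a time: Y and the earlier draws
    form the past, and the new draw is integrated against the prior with the past frozen. *)

Section powR_inequalities.
Context {R : realType}.
Implicit Types p x s : R.

Lemma expR_le_quadratic (x : R) : `|x| <= 2^-1 -> expR x <= 1 + x + 2 * x ^+ 2.
Proof.
move=> /ler_normlP[x1 x2].
have x0 : 0 < 1 - x by lra.
have : expR x <= (1 - x)^-1.
  by rewrite -[expR x]invrK -expRN lef_pV2 ?posrE ?expR_gt0// expR_ge1Dx.
move=> /le_trans; apply.
rewrite -div1r ler_pdivrMr//.
(* This is (1 - x)(1 + x + 2x^2) - 1. *)
have : 0 <= x ^+ 2 * (1 - 2 * x) by rewrite mulr_ge0 ?sqr_ge0//; lra.
nra.
Qed.

(** For |px| <= 1/2, use [1 + x <= expR x] and the quadratic bound on [expR]. Otherwise 1 < 2p|x|: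
    then (2p+1)^p |x|^p dominates the left side and (2p)^p |x|^p compensates a negative px. *)
Lemma normr1D_powR_le p x : 1 <= p ->
  `|1 + x| `^ p <= 1 + p * x + 2 * (p * x) ^+ 2 +
    ((2 * p + 1) `^ p + (2 * p) `^ p) * `|x| `^ p.
Proof.
move=> p1; have p0 : 0 < p by exact: lt_le_trans p1.
have [px|px] := leP (`|p * x|) 2^-1.
  have x1 : `|x| <= 2^-1.
    apply: le_trans px; rewrite normrM ger0_norm ?(ltW p0)//.
    by rewrite ler_peMl.
  have x0 : 0 <= 1 + x by move/ler_normlP : x1 => [? ?]; lra.
  rewrite ger0_norm//.
  apply: (@le_trans _ _ (1 + p * x + 2 * (p * x) ^+ 2)); last first.
    by rewrite lerDl mulr_ge0 ?addr_ge0 ?powR_ge0.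
  apply: le_trans (expR_le_quadratic px).
  rewrite mulrC expRM ge0_ler_powR ?nnegrE ?expR_ge0 ?expR_ge1Dx ?(ltW p0)//.
have px' : 1 < 2 * p * `|x|.
  by move: px; rewrite normrM (ger0_norm (ltW p0)); lra.
rewrite [X in _ <= _ + X]mulrDl -!powRM ?normr_ge0//; [|lra..].
have H1 : `|1 + x| `^ p <= ((2 * p + 1) * `|x|) `^ p.
  apply: ge0_ler_powR; rewrite ?nnegrE ?(ltW p0)// ?mulr_ge0//; first by lra.
  by apply: (le_trans (ler_normD _ _)); rewrite normr1 mulrDl mul1r lerD2r ltW.
have H2 : 2 * p * `|x| <= (2 * p * `|x|) `^ p by rewrite le1r_powR// ltW.
have H3 : - (p * `|x|) <= p * x.
  by rewrite -mulrN ler_wpM2l ?(ltW p0)// lerNl ler_normr lexx orbT.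
have H4 : 0 <= (p * x) ^+ 2 by exact: sqr_ge0.
have H5 : 0 <= p * `|x| by rewrite mulr_ge0// ltW.
lra.
Qed.

(** The first two summands come from [normr1D_powR_le], the third from turning its quadratic term
    into a p-th power. *)
Definition MZ_cst p : R :=
  (2 * p + 1) `^ p + (2 * p) `^ p + (2 * p ^+ 2) `^ (p / 2).

Lemma MZ_cst_ge1 p : 1 <= p -> 1 <= MZ_cst p.
Proof.
move=> p1; rewrite /MZ_cst -addrA -[leLHS]addr0 lerD ?addr_ge0 ?powR_ge0//.
by apply: le_trans (le1r_powR _ _) => //; lra.
Qed.

Lemma MZ_cst_gt0 p : 1 <= p -> 0 < MZ_cst p.
Proof. by move=> /MZ_cst_ge1; exact: lt_le_trans. Qed.

(** If the left side w exceeds 1/n then wn >= 1, hence w <= w(wn)^(p/2 - 1), which is the second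
    term. Summed over n draws, the weight n^(p/2 - 1) becomes n^(p/2). *)
Lemma sqr_le_weighted p (n x : R) : 2 <= p -> 1 <= n ->
  2 * (p * x) ^+ 2 <= n^-1 + (2 * p ^+ 2) `^ (p / 2) * n `^ (p / 2 - 1) * `|x| `^ p.
Proof.
move=> p2 n1; have p0 : 0 <= p by lra.
set w := _ * _ ^+ 2.
have w0 : 0 <= w by rewrite mulr_ge0// sqr_ge0.
have n0 : 0 < n by exact: lt_le_trans n1.
have [wn|wn] := leP w n^-1.
  by rewrite (le_trans wn)// lerDl !mulr_ge0// powR_ge0.
apply: (@le_trans _ _ (0 + w)); first by rewrite add0r.
apply: lerD; first by rewrite invr_ge0 ltW.
have w1 : 1 <= w * n by rewrite -ler_pdivrMr// div1r ltW.
have -> : (2 * p ^+ 2) `^ (p / 2) * n `^ (p / 2 - 1) * `|x| `^ p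
    = w * (w * n) `^ (p / 2 - 1).
  rewrite (powRM _ w0 (ltW n0)) mulrA mulr_powRB1//; last by lra.
  have -> : w = (2 * p ^+ 2) * `|x| ^+ 2.
    by rewrite /w real_normK ?num_real// exprMn mulrA.
  rewrite (@powRM _ (2 * p ^+ 2)) ?mulr_ge0 ?sqr_ge0//.
  have -> : (`|x| ^+ 2) `^ (p / 2) = `|x| `^ p.
    by rewrite -powR_mulrn// -powRrM; congr (_ `^ _); lra.
  by rewrite mulrAC.
apply: ler_peMr => //.
by rewrite -[leLHS](powRr0 (w * n)); apply: ler_powR => //; lra.
Qed.

(* The factor [1 + n^-1] is harmless when the inequality is iterated [n] times;
   the term linear in [x] disappears on integrating a centred [x]. *)
Lemma normrD_powR_le p (n s : R) : 2 <= p -> 1 <= n -> exists B, forall x,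
  `|s + x| `^ p <=
  (1 + n^-1) * `|s| `^ p + B * x + MZ_cst p * n `^ (p / 2 - 1) * `|x| `^ p.
Proof.
move=> p2 n1; have p1 : 1 <= p by lra.
have n0 : 0 < n by exact: lt_le_trans n1.
have np1 : 1 <= n `^ (p / 2 - 1).
  by rewrite -[leLHS](powRr0 n); apply: ler_powR => //; lra.
have [->|s0] := eqVneq s 0.
  exists 0 => x; rewrite add0r normr0 powR0 ?gt_eqF//; last by lra.
  rewrite mulr0 mul0r !add0r ler_peMl ?powR_ge0//.
  by rewrite mulr_ege1 ?MZ_cst_ge1.
(* The derivative of |s|^p; the rest is [normr1D_powR_le] at [x / s], scaled by |s|^p. *)
exists (p * `|s| `^ p / s) => x.
have h := normr1D_powR_le (x / s) p1.
have -> : s + x = s * (1 + x / s) by rewrite mulrDr mulr1 mulrCA divff// mulr1.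
rewrite normrM (powRM _ (normr_ge0 _) (normr_ge0 _)).
have := sqr_le_weighted (x / s) p2 n1.
set c := _ `^ (p / 2) => hc.
have sp0 : 0 <= `|s| `^ p by exact: powR_ge0.
have -> : (`|x| `^ p) = `|s| `^ p * `|x / s| `^ p.
  by rewrite -powRM// -normrM mulrCA divff// mulr1.
have := ler_wpM2l sp0 h => {h}; move=> /le_trans; apply.
rewrite -subr_ge0.
set k1 := _ + _ `^ p; set z := `|x / s| `^ p.
have z0 : 0 <= z by exact: powR_ge0.
have -> : MZ_cst p = k1 + c by rewrite /MZ_cst.
have k10 : 0 <= k1 by rewrite addr_ge0 ?powR_ge0.
have E : p * `|s| `^ p / s * x = `|s| `^ p * (p * (x / s)) by field.
rewrite E.
have hz : k1 * z <= k1 * n `^ (p / 2 - 1) * z by rewrite -mulrA ler_wpM2l// ler_peMl.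
have : 0 <= `|s| `^ p * (
    (n^-1 + c * n `^ (p / 2 - 1) * z - 2 * (p * (x / s)) ^+ 2) +
    (k1 * n `^ (p / 2 - 1) * z - k1 * z)).
  by rewrite mulr_ge0// addr_ge0// subr_ge0.
nra.
Qed.

End powR_inequalities.

(** * Independence of a new draw from the past *)

Section independence.
Context d d1 d2 (Om : measurableType d) (T1 : measurableType d1)
  (T2 : measurableType d2) (R : realType) (P : probability Om R).

(** The joint law and the product of the laws agree on rectangles, hence everywhere, and Tonelli's
    theorem applies. The outer integral stays on [Om], so that [X] may be the identity into a
    coarser sigma-algebra. *)
Lemma indep_pair_integral (X : {mfun Om >-> T1}) (Z : {mfun Om >-> T2})
    (g : (T1 * T2)%type -> \bar R) :
  indep_pair P X Z -> measurable_fun setT g ->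
  (forall xt, (0 <= g xt)%E) ->
  (\int[P]_w g (X w, Z w) =
   \int[P]_w \int[distribution P Z]_t g (X w, t))%E.
Proof.
move=> XZ mg g0.
have mXZ : measurable_fun setT (fun w => (X w, Z w)).
  exact: measurable_fun_pair.
pose XZm : {mfun Om >-> (T1 * T2)%type} := HB.pack (fun w => (X w, Z w))
  (isMeasurableFun.Build _ _ _ _ _ mXZ).
transitivity (\int[distribution P XZm]_xt g xt)%E.
  by rewrite ge0_integral_distribution.
transitivity (\int[distribution P X \x distribution P Z]_xt g xt)%E.
  apply: eq_measure_integral => /= A mA _; apply/esym.
  by apply: product_measure_unique => // A1 A2 mA1 mA2; exact: XZ.
rewrite fubini_tonelli1// ge0_integral_distribution//.
  exact: measurable_fun_fubini_tonelli_F.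
by move=> x; exact: integral_ge0.
Qed.

Variables (X : {mfun Om >-> T1}) (Z : nat -> {mfun Om >-> T2}).

(* A pi-system generating the sigma-algebra of X, Z_0, ..., Z_(n-1). *)
Definition past_events (n : nat) : set (set Om) :=
  [set C | exists A B, [/\ measurable A, forall m, measurable (B m) &
     C = X @^-1` A `&` \bigcap_(m in `I_n) (Z m @^-1` B m)]].

Lemma past_events_measurable n : past_events n `<=` measurable.
Proof.
move=> _ [A [B [mA mB ->]]]; apply: measurableI; first exact: measurable_funPTI.
by apply: fin_bigcap_measurable => // m _; exact: measurable_funPTI.
Qed.

Lemma past_events_setI n : setI_closed (past_events n).
Proof.
move=> _ _ [A [B [mA mB ->]]] [A' [B' [mA' mB' ->]]].
exists (A `&` A'), (fun m => B m `&` B' m); split; first exact: measurableI.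
  by move=> m; exact: measurableI.
rewrite setIACA -bigcapI preimage_setI; congr (_ `&` _).
Qed.

Lemma past_eventsT n : past_events n setT.
Proof.
exists setT, (fun=> setT); split => //.
by apply/seteqP; split.
Qed.

Local Notation past n := (g_sigma_algebraType (past_events n)).

Lemma measurable_past_id n :
  measurable_fun [set: Om] (id : Om -> past n).
Proof.
move=> _ C sC; rewrite setTI.
apply: (smallest_sub _ (@past_events_measurable n)) sC.
exact: sigma_algebra_measurable.
Qed.

(** With the identity seen as a random variable into the sigma-algebra of the past, independence
    from the past becomes an instance of [indep_pair], and conditional expectations are avoided. *)
Definition past_id n : {mfun Om >-> past n} := HB.pack (id : Om -> past n)
  (isMeasurableFun.Build _ _ _ _ _ (@measurable_past_id n)).

Lemma measurable_past_X n : measurable_fun [set: past n] X.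
Proof.
move=> _ A mA; rewrite setTI; apply: sub_sigma_algebra.
by exists A, (fun=> setT); split => //; apply/seteqP; split => // w [].
Qed.

Lemma measurable_past_Z n m : (m < n)%N -> measurable_fun [set: past n] (Z m).
Proof.
move=> mn _ A mA; rewrite setTI; apply: sub_sigma_algebra.
exists setT, (fun i => if i == m then A else setT); split => //.
  by move=> i; case: ifP.
apply/seteqP; split => w /=.
  by move=> Aw; split => // i _ /=; case: eqP => // ->.
by move=> [_ /(_ m mn)] /=; rewrite eqxx.
Qed.

(** For fixed [B], the finite measures sending C to P(C and Z_n in B) and to P(Z_n in B) P(C) agree
    on the pi-system [past_events n], hence on the sigma-algebra it generates. *)
Lemma indep_draws_past N n : indep_draws P X N Z -> (n < N)%N ->
  indep_pair P (past_id n) (Z n).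
Proof.
move=> indep nN C B sC mB; rewrite -[past_id n @^-1` C]/C.
have mZB : measurable (Z n @^-1` B) by exact: measurable_funPTI.
pose r : {nonneg R} := NngNum (fine_ge0 (measure_ge0 P (Z n @^-1` B))).
have rE : P (Z n @^-1` B) = r%:num%:E by rewrite /= fineK// fin_num_measure.
transitivity (mscale r P C); last by rewrite rE muleC.
apply: (@g_sigma_algebra_measure_unique _ R Om (past_events n)
  (@past_events_measurable n) (fun=> setT) _ _ (mrestr P mZB) (mscale r P)) => //.
- by move=> _; exact: past_eventsT.
- by rewrite bigcup_const//; exists 0%N.
- exact: past_events_setI.
- move=> _ [A [B' [mA mB' ->]]].
  have main (B1 : nat -> set T2) : (forall m, measurable (B1 m)) ->
      P (X @^-1` A `&` \bigcap_(m in `I_n.+1) (Z m @^-1` B1 m)) =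
      (P (X @^-1` A) * \prod_(m < n.+1) P (Z m @^-1` B1 m))%E.
    (* The full space in the slots beyond [n] reduces the hypothesis on [N] draws to the first
       [n.+1]. *)
    move=> mB1; pose B2 m := if (m < n.+1)%N then B1 m else setT.
    have mB2 m : measurable (B2 m) by rewrite /B2; case: ifP.
    rewrite (big_ord_widen _ (fun m => P (Z m @^-1` B1 m)) nN) big_mkcond/=.
    have := indep A B2 mA mB2.
    have -> : \bigcap_(m in `I_N) (Z m @^-1` B2 m) =
        \bigcap_(m in `I_n.+1) (Z m @^-1` B1 m).
      apply/seteqP; split=> w Bw m /= mn.
        by have := Bw m (leq_trans mn nN); rewrite /B2/= mn.
      rewrite /B2 /=; case: ifPn => // mn'; exact: Bw.
    move=> ->; congr (_ * _)%E; apply: eq_bigr => i _.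
    by rewrite /B2; case: ifP => //; rewrite preimage_setT probability_setT.
  (* Slot [n] holds [B] in one family and the full space in the other, so the two product formulas
     differ only by the factor of [Z n]. *)
  pose B1 m := if m == n then B else B' m.
  pose B1' m := if m == n then setT else B' m.
  have mB1 m : measurable (B1 m) by rewrite /B1; case: ifP.
  have mB1' m : measurable (B1' m) by rewrite /B1'; case: ifP.
  have := main _ mB1; have := main _ mB1'.
  have B1n : B1 n = B by rewrite /B1 eqxx.
  have B1'n : B1' n = setT by rewrite /B1' eqxx.
  rewrite !big_ord_recr/= B1n B1'n preimage_setT probability_setT mule1.
  have eqB (i : 'I_n) : B1 i = B1' i by rewrite /B1 /B1' ltn_eqF.
  under [in X in _ -> X -> _]eq_bigr do rewrite eqB.
  move=> h1 h2; rewrite /mrestr /mscale/=.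
  have -> : \bigcap_(m in `I_n) (Z m @^-1` B' m) =
     \bigcap_(m in `I_n.+1) (Z m @^-1` B1' m).
    apply/seteqP; split=> w Bw m /= mn.
      rewrite /B1'; case: eqP => // /eqP mn'; apply: Bw => /=.
      by rewrite ltn_neqAle mn' -ltnS.
    have := Bw m (ltnW mn); rewrite /B1'; case: eqP => // mn'.
    by move: mn => /=; rewrite mn' ltnn.
  rewrite h1 fineK ?fin_num_measure// muleC -muleA -h2.
  congr (P _); apply/seteqP; split=> w /=.
    move=> [[Aw Bw] Zw]; split => // m mn; have := Bw m mn.
    by rewrite /B1 /B1'; case: eqP => // ->.
  move=> [Aw Bw]; split; last by have := Bw n (ltnSn n); rewrite /B1 /= eqxx.
  split => // m mn; have := Bw m mn; rewrite /B1 /B1' /=; case: eqP => //.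
- by move=> _ /=; rewrite /mrestr setTI (le_lt_trans (probability_le1 _ _))// ltry.
Qed.

End independence.
Arguments measurable_past_id {d d1 d2 Om T1 T2} X Z n.
Arguments past_id {d d1 d2 Om T1 T2} X Z n.

Lemma measurable_fun_comp2 d d1 d2 d3 (T : measurableType d)
    (T1 : measurableType d1) (T2 : measurableType d2) (T3 : measurableType d3)
    (phi : T1 -> T2 -> T3) (f : T -> T1) (g : T -> T2) :
  measurable_fun setT (fun yt : T1 * T2 => phi yt.1 yt.2) ->
  measurable_fun setT f -> measurable_fun setT g ->
  measurable_fun setT (fun w => phi (f w) (g w)).
Proof.
by move=> mphi mf mg; exact: (measurableT_comp mphi (measurable_fun_pair mf mg)).
Qed.

Lemma measurable_fun_integral2 d1 d2 (T1 : measurableType d1)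
    (T2 : measurableType d2) (R : realType)
    (mu : {sigma_finite_measure set T2 -> \bar R}) (phi : T1 -> T2 -> \bar R) :
  measurable_fun setT (fun yt : T1 * T2 => phi yt.1 yt.2) ->
  (forall y t, (0 <= phi y t)%E) ->
  measurable_fun setT (fun y => \int[mu]_t phi y t)%E.
Proof.
move=> mphi phi0.
have phi0' (yt : T1 * T2) : (0 <= phi yt.1 yt.2)%E by exact: phi0.
exact: (measurable_fun_fubini_tonelli_F (m2 := mu) _ mphi phi0').
Qed.

(** * The Marcinkiewicz-Zygmund inequality *)

Section moments_of_iid_sums.
Context d d1 d2 (Om : measurableType d) (T1 : measurableType d1)
  (T2 : measurableType d2) (R : realType) (P : probability Om R).

(** Integrating [normrD_powR_le] removes its linear term, [x] being centred. *)
Lemma integral_normrD_powR_le (mu : probability T2 R) (x : T2 -> R)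
    (p n s : R) : 2 <= p -> 1 <= n ->
  mu.-integrable setT (EFin \o x) -> (\int[mu]_t (x t)%:E = 0)%E ->
  (\int[mu]_t (`|s + x t| `^ p)%:E <=
   ((1 + n^-1) * `|s| `^ p)%:E +
   (MZ_cst p * n `^ (p / 2 - 1))%:E * \int[mu]_t (`|x t| `^ p)%:E)%E.
Proof.
move=> p2 n1 ix x0.
have mx : measurable_fun setT x by apply/measurable_EFinP; case/integrableP: ix.
have mxp : measurable_fun setT (fun t => `|x t| `^ p).
  by apply: (measurableT_comp (measurable_powR _)); exact: measurableT_comp.
have msxp : measurable_fun setT (fun t => `|s + x t| `^ p).
  apply: (measurableT_comp (measurable_powR _)); apply: measurableT_comp => //.
  exact: measurable_funD.
set C := MZ_cst p * _.
have C0 : 0 < C.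
  rewrite mulr_gt0 ?powR_gt0//; last exact: lt_le_trans n1.
  by apply: MZ_cst_gt0; lra.
have I0 : (0 <= \int[mu]_t (`|x t| `^ p)%:E)%E.
  by apply: integral_ge0 => t _; rewrite lee_fin powR_ge0.
(* With an infinite p-th moment the right side is [+oo], because [C] is positive; otherwise the
   majorant is integrable. *)
have [Ioo|Ioo] := eqVneq (\int[mu]_t (`|x t| `^ p)%:E)%E +oo%E.
  by rewrite Ioo gt0_muley ?lte_fin// addey ?leey.
have ixp : mu.-integrable setT (fun t => (`|x t| `^ p)%:E).
  apply/integrableP; split; first exact/measurable_EFinP.
  under eq_integral do rewrite abse_EFin ger0_norm ?powR_ge0//.
  by rewrite ltey.
have [B hB] := normrD_powR_le s p2 n1.
pose g t := (((1 + n^-1) * `|s| `^ p)%:E + B%:E * (x t)%:E + C%:E * (`|x t| `^ p)%:E)%E.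
have i1 : mu.-integrable setT (cst ((1 + n^-1) * `|s| `^ p)%:E).
  exact: finite_measure_integrable_cst.
have i2 : mu.-integrable setT (fun t => B%:E * (x t)%:E)%E by exact: integrableZl.
have i12 : mu.-integrable setT
    (fun t => ((1 + n^-1) * `|s| `^ p)%:E + B%:E * (x t)%:E)%E.
  exact: integrableD.
have i3 : mu.-integrable setT (fun t => C%:E * (`|x t| `^ p)%:E)%E.
  exact: integrableZl.
have ig : mu.-integrable setT g by exact: integrableD.
apply: (@le_trans _ _ (\int[mu]_t g t)%E).
  apply: ge0_le_integral => //.
  - exact/measurable_EFinP.
  - by case/integrableP: ig.
  - by move=> t _; rewrite /g -!EFinM -!EFinD lee_fin; exact: hB.
rewrite /g integralD// integralD// !integralZl// x0 mule0 adde0.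
by rewrite integral_cst// [X in (_ * X)%E]probability_setT mule1.
Qed.

Variables (X : {mfun Om >-> T1}) (Z : nat -> {mfun Om >-> T2}).
Variables (N : nat) (mu : probability T2 R) (phi : T1 -> T2 -> R) (p : R).
Hypothesis indep : indep_draws P X N Z.
Hypothesis lawZ : forall m A, (m < N)%N -> measurable A ->
  distribution P (Z m) A = mu A.
Hypothesis mphi : measurable_fun setT (fun yt : T1 * T2 => phi yt.1 yt.2).
Hypothesis iphi : forall y, mu.-integrable setT (EFin \o phi y).
Hypothesis phi0 : forall y, (\int[mu]_t (phi y t)%:E = 0)%E.
Hypothesis p2 : 2 <= p.

Let moment := (\int[P]_w \int[mu]_t (`|phi (X w) t| `^ p)%:E)%E.

(** Measurability is with respect to the past of [b] draws, as independence of the next draw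
    requires. *)
Lemma measurable_partial_sum a b : (b <= N)%N ->
  measurable_fun setT
    (fun w : g_sigma_algebraType (past_events X Z b) =>
       \sum_(a <= m < b) phi (X w) (Z m w)).
Proof.
move=> bN; rewrite (_ : (fun _ => _) = (fun w =>
  \sum_(m <- index_iota a b) (if (m < b)%N then phi (X w) (Z m w) else 0))).
  apply: measurable_sum => m; case: (boolP (m < b)%N) => // mb.
  apply: measurable_fun_comp2 => //; first exact: measurable_past_X.
  exact: measurable_past_Z.
apply/funext => w; rewrite -[in RHS](big_mkcond (fun m => m < b)%N).
rewrite [LHS]big_nat_cond [RHS]big_nat_cond.
by apply: eq_bigl => m; rewrite andbT; case: (m < b)%N; rewrite !(andbT, andbF).
Qed.

(** [n] stays fixed along the induction on [j]: each draw costs a factor [1 + n^-1] and adds one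
    copy of the constant, so [n] can be chosen at the end as the number of draws. *)
Lemma moment_partial_sum_rec a j (n : R) : (a + j <= N)%N -> 1 <= n ->
  (\int[P]_w (`|\sum_(a <= m < a + j) phi (X w) (Z m w)| `^ p)%:E <=
  ((1 + n^-1) ^+ j * j%:R * (MZ_cst p * n `^ (p / 2 - 1)))%:E * moment)%E.
Proof.
move=> + n1; have n0 : 0 <= n^-1 by rewrite invr_ge0 (le_trans _ n1).
set C := MZ_cst p * _.
have C0 : 0 <= C.
  by rewrite mulr_ge0 ?powR_ge0//; apply/ltW/MZ_cst_gt0; move: p2; lra.
have I0 : (0 <= moment)%E.
  by do 2 apply: integral_ge0 => ? _; rewrite lee_fin powR_ge0.
elim: j => [_|j IH ajN].
  rewrite addn0 mulr0 mul0r mul0e; under eq_integral do rewrite big_geq//.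
  rewrite normr0 powR0; last by rewrite gt_eqF//; move: p2; lra.
  by rewrite integral0.
have ajN' : (a + j < N)%N by rewrite -addnS.
pose S w := \sum_(a <= m < a + j) phi (X w) (Z m w).
have mS : measurable_fun setT (S : g_sigma_algebraType (past_events X Z (a + j)) -> R).
  by apply: measurable_partial_sum; exact: ltnW.
have mS' : measurable_fun setT S.
  exact: (measurableT_comp mS (measurable_past_id X Z (a + j))).
pose g (wt : g_sigma_algebraType (past_events X Z (a + j)) * T2) :=
  (`|S wt.1 + phi (X wt.1) wt.2| `^ p)%:E.
have mphip : measurable_fun setT (fun wt : T1 * T2 => (`|phi wt.1 wt.2| `^ p)%:E).
  apply/measurable_EFinP; apply: (measurableT_comp (measurable_powR _)).
  exact: measurableT_comp.
have [J [JE mJ J_ge0 momentE]] : exists J : Om -> \bar R,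
    [/\ forall w, J w = (\int[mu]_t (`|phi (X w) t| `^ p)%:E)%E,
    measurable_fun setT J, forall w, (0 <= J w)%E & (moment = \int[P]_w J w)%E].
  exists (fun w => \int[mu]_t (`|phi (X w) t| `^ p)%:E)%E; split => //.
    have h := measurable_fun_integral2 mu
      (phi := fun y t => (`|phi y t| `^ p)%:E) mphip _.
    by apply: (measurableT_comp (h _)) => // y t; rewrite lee_fin powR_ge0.
  by move=> w; apply: integral_ge0 => t _; rewrite lee_fin powR_ge0.
have mSp : measurable_fun setT (fun w => (`|S w| `^ p)%:E).
  apply/measurable_EFinP; apply: (measurableT_comp (measurable_powR _)).
  exact: measurableT_comp.
rewrite momentE in IH *.
have step : (\int[P]_w (`|\sum_(a <= m < a + j.+1) phi (X w) (Z m w)| `^ p)%:E <=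
    \int[P]_w ((1 + n^-1)%:E * (`|S w| `^ p)%:E + C%:E * J w))%E.
have mg : measurable_fun setT g.
  apply/measurable_EFinP; apply: (measurableT_comp (measurable_powR _)).
  apply: measurableT_comp => //; apply: measurable_funD.
    exact: measurableT_comp.
  apply: (measurable_fun_comp2 (phi := phi)) => //; apply: measurableT_comp => //.
  exact: measurable_past_X.
pose G (w : g_sigma_algebraType (past_events X Z (a + j))) :=
  (\int[mu]_t (`|S w + phi (X w) t| `^ p)%:E)%E.
have mG : measurable_fun setT G.
  apply: (measurable_fun_integral2 mu (phi := fun (w : g_sigma_algebraType
    (past_events X Z (a + j))) t => (`|S w + phi (X w) t| `^ p)%:E)) => //.
have mG' : measurable_fun setT (fun w : Om => G w).
  exact: (measurableT_comp mG (measurable_past_id X Z (a + j))).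
have -> : (\int[P]_w (`|\sum_(a <= m < a + j.+1) phi (X w) (Z m w)| `^ p)%:E =
    \int[P]_w g (past_id X Z (a + j) w, Z (a + j)%N w))%E.
  by apply: eq_integral => w _; rewrite addnS big_nat_recr//= leq_addr.
have g0 wt : (0 <= g wt)%E by rewrite lee_fin powR_ge0.
(* The new draw is independent of the past, on which [S] and [X] depend, so it is integrated against
   its own law with the past frozen. *)
rewrite (indep_pair_integral (indep_draws_past indep ajN') mg g0).
have -> : (\int[P]_w \int[distribution P (Z (a + j))]_t g (past_id X Z (a + j) w, t) =
    \int[P]_w G w)%E.
  apply: eq_integral => w _.
  transitivity (\int[mu]_t g (past_id X Z (a + j) w, t))%E; last by [].
  by apply: eq_measure_integral => A mA _; exact: lawZ.
apply: ge0_le_integral => //.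
  - by move=> w _; apply: integral_ge0 => t _; rewrite lee_fin powR_ge0.
  - by apply: emeasurable_funD; exact: measurable_funeM.
  - by move=> w _; rewrite /G JE -EFinM; exact: integral_normrD_powR_le.
apply: (le_trans step).
have Sp0 w : (0 <= (`|S w| `^ p)%:E)%E by rewrite lee_fin powR_ge0.
have n10 : (0 <= (1 + n^-1)%:E)%E by rewrite lee_fin addr_ge0.
rewrite ge0_integralD//; last 4 first.
- by move=> w _; exact: mule_ge0.
- exact: measurable_funeM.
- by move=> w _; exact: mule_ge0.
- exact: measurable_funeM.
rewrite !ge0_integralZl//.
apply: (@le_trans _ _ ((1 + n^-1)%:E *
  (((1 + n^-1) ^+ j * j%:R * C)%:E * \int[P]_w J w) + C%:E * \int[P]_w J w)%E).
  by apply: leeD => //; apply: lee_wpmul2l => //; exact: IH (ltnW ajN').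
have J0 : (0 <= \int[P]_w J w)%E by exact: integral_ge0.
have K0 : 0 <= (1 + n^-1) * ((1 + n^-1) ^+ j * j%:R * C).
  rewrite mulrA mulrA -exprS; apply: mulr_ge0 => //.
  by rewrite mulr_ge0// exprn_ge0// addr_ge0.
rewrite muleA -EFinM -ge0_muleDl ?lee_fin//.
apply: lee_wpmul2r => //.
rewrite -EFinD lee_fin.
rewrite -[j.+1]addn1 natrD exprD expr1 [X in _ <= X]mulrAC.
(* The constant contributed by the new draw is enlarged by a factor at least 1 so as to merge with
   the [j] earlier ones. *)
have h1 : 1 <= (1 + n^-1) ^+ j * (1 + n^-1).
  by rewrite -exprSr exprn_ege1// lerDl.
have := ler_wpM2r C0 h1.
nra.
Qed.

(** For n draws the recursion is used with parameter n: (1 + 1/n)^n <= e, and n times n^(p/2 - 1) is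
    n^(p/2). *)
Lemma marcinkiewicz_zygmund a b : (a <= b <= N)%N ->
  (\int[P]_w (`|\sum_(a <= m < b) phi (X w) (Z m w)| `^ p)%:E <=
  (expR 1 * MZ_cst p * (b - a)%:R `^ (p / 2))%:E * moment)%E.
Proof.
move=> /andP[]; rewrite leq_eqVlt => /predU1P[<- _|ab bN].
  under eq_integral do rewrite big_geq//.
  rewrite normr0 powR0 ?integral0; last by rewrite gt_eqF//; move: p2; lra.
  rewrite mule_ge0 ?lee_fin ?mulr_ge0 ?expR_ge0 ?powR_ge0 ?addr_ge0 ?powR_ge0//.
  by do 2 apply: integral_ge0 => ? _; rewrite lee_fin powR_ge0.
have [j jE] : exists j, b = (a + j.+1)%N.
  by exists (b - a).-1; rewrite prednK ?subn_gt0// subnKC// ltnW.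
rewrite jE addKn; rewrite jE in bN.
have n1 : 1 <= j.+1%:R :> R by rewrite ler1n.
apply: le_trans (moment_partial_sum_rec bN n1) _.
apply: lee_wpmul2r; first by do 2 apply: integral_ge0 => ? _; rewrite lee_fin powR_ge0.
rewrite lee_fin; set k : R := j.+1%:R.
have k0 : 0 < k by rewrite ltr0n.
have C0 : 0 <= MZ_cst p by apply/ltW/MZ_cst_gt0; move: p2; lra.
rewrite mulrACA -mulrA [k * _]mulr_powRB1//; last by move: p2; lra.
have : (1 + k^-1) ^+ j.+1 <= expR 1.
  apply: (@le_trans _ _ (expR (k^-1) ^+ j.+1)).
    by rewrite lerXn2r ?nnegrE ?expR_ge0 ?addr_ge0 ?invr_ge0 ?expR_ge1Dx// ltW.
  by rewrite -expRM_natl divff ?gt_eqF.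
rewrite -mulrA => h; apply: ler_wpM2r => //.
by rewrite mulr_ge0 ?powR_ge0.
Qed.
End moments_of_iid_sums.

(** * Positivity of the evidence *)

Lemma lebesgue_measure_addr (R : realType) (a : R) (A : set (measurableTypeR R)) :
  measurable A -> lebesgue_measure ((+%R a) @^-1` A) = lebesgue_measure A.
Proof.
move=> mA; have ma : measurable_fun setT (+%R a : measurableTypeR R -> measurableTypeR R).
  exact: measurable_funD.
pose am : {mfun (measurableTypeR R) >-> (measurableTypeR R)} :=
  HB.pack (+%R a : measurableTypeR R -> measurableTypeR R)
    (isMeasurableFun.Build _ _ _ _ _ ma).
apply/esym; apply: (@lebesgue_measure_unique _ (pushforward lebesgue_measure am)) => //.
move=> _ [[x y] _ <-].
rewrite -[RHS]/(lebesgue_measure ((+%R a) @^-1` `]x, y]%classic)).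
rewrite (_ : _ @^-1` _ = `](x - a), (y - a)]%classic); last first.
  by apply/seteqP; split=> z /=; rewrite !in_itv/= ltrBlDl lerBrDl.
rewrite !lebesgue_measure_itv/= !lte_fin ltrD2r; case: ifP => // _.
by rewrite -!EFinD; congr (_%:E); ring.
Qed.

Lemma measurable_rV_add (R : realType) n (a : 'rV[R]_n) :
  measurable_fun setT (+%R a).
Proof.
apply: measurable_fun_rV => i; rewrite (_ : _ \o _ = (fun v => a ord0 i + rV_coord i v)).
  apply: measurable_funD => //; exact: measurable_rV_coord.
by apply/funext => v; rewrite /rV_coord/= mxE.
Qed.

(** Through [rV_cons] a translation acts separately on the first coordinate and on the tail; both
    factors are invariant, and uniqueness of the product measure concludes. *)
Lemma lebesgue_rV_addr (R : realType) n (a : 'rV[R]_n) (A : set 'rV[R]_n) :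
  measurable A -> lebesgue_rV R n ((+%R a) @^-1` A) = lebesgue_rV R n A.
Proof.
elim: n a A => [|n IH] a A mA.
  rewrite (_ : _ @^-1` A = A)//.
  have aE (v : 'rV[R]_0) : a + v = v by apply/rowP => -[].
  by apply/seteqP; split=> v; rewrite /= aE.
rewrite /= /lebesgue_rV_step /pushforward.
pose b : 'rV[R]_n := \row_j a ord0 (lift ord0 j).
pose sh (xv : measurableTypeR R * 'rV[R]_n) : measurableTypeR R * 'rV[R]_n :=
  (a ord0 ord0 + xv.1, b + xv.2).
have msh : measurable_fun setT sh.
  apply: measurable_fun_pair; first by apply: measurable_funD.
  by apply: (measurableT_comp (measurable_rV_add b)).
pose shm : {mfun (measurableTypeR R * 'rV[R]_n)%type >->
    (measurableTypeR R * 'rV[R]_n)%type} :=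
  HB.pack sh (isMeasurableFun.Build _ _ _ _ _ msh).
have -> : rV_cons (R := R) (n := n) @^-1` ((+%R a) @^-1` A) =
    sh @^-1` (rV_cons (R := R) (n := n) @^-1` A).
  apply/funext => xv; rewrite /preimage/=; congr (A _).
  apply/rowP => i; rewrite !mxE; have [j ->|->] := unliftP ord0 i.
    by rewrite /sh /= !mxE.
  by [].
have mB : measurable (rV_cons (R := R) (n := n) @^-1` A).
  by rewrite -[X in measurable X]setTI; exact: measurable_rV_cons.
apply/esym.
apply: (product_measure_unique (m1 := lebesgue_measure) (m2 := lebesgue_rV R n)
  (m' := pushforward (lebesgue_measure \x lebesgue_rV R n)%E shm)) => // A1 A2 mA1 mA2.
rewrite -[LHS]/((lebesgue_measure \x lebesgue_rV R n)%E (sh @^-1` (A1 `*` A2))).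
rewrite (_ : _ @^-1` _ = ((+%R (a ord0 ord0)) @^-1` A1) `*` ((+%R b) @^-1` A2)); last first.
  by apply/seteqP; split.
rewrite product_measure1E.
- by congr (_ * _)%E; [exact: lebesgue_measure_addr | exact: IH].
- by rewrite -[X in measurable X]setTI; exact: measurable_funD.
- by rewrite -[X in measurable X]setTI; exact: measurable_rV_add.
Qed.

Lemma measurable_rV_sub d (T : measurableType d) (R : realType) n
    (u v : T -> 'rV[R]_n) :
  measurable_fun setT u -> measurable_fun setT v ->
  measurable_fun setT (fun w => u w - v w).
Proof.
move=> mu mv; apply: measurable_fun_rV => i.
rewrite (_ : _ \o _ = (fun w => rV_coord i (u w) - rV_coord i (v w))); last first.
  by apply/funext => w; rewrite /rV_coord/= !mxE.
by apply: measurable_funB; apply: measurableT_comp => //; exact: measurable_rV_coord.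
Qed.

Lemma measurable_likelihood (R : realType) s k (rho : 'rV[R]_k -> R)
    (h : 'rV[R]_s -> 'rV[R]_k) :
  measurable_fun setT rho -> measurable_fun setT h ->
  measurable_fun setT (fun yt : 'rV[R]_k * 'rV[R]_s => likelihood rho h yt.1 yt.2).
Proof.
move=> mrho mh; apply: (measurableT_comp mrho); apply: measurable_rV_sub => //.
exact: measurableT_comp.
Qed.

Section observation_density.
Context (R : realType) (s k : nat) (disp : measure_display)
  (Omega : measurableType disp) (P : probability Omega R)
  (theta : {RV P >-> 'rV[R]_s}) (eps Y : {RV P >-> 'rV[R]_k})
  (rho : 'rV[R]_k -> R) (h : 'rV[R]_s -> 'rV[R]_k).
Hypotheses (h_meas : measurable_fun [set: 'rV[R]_s] h)
  (eps_density : has_density (lebesgue_rV R k) (distribution P eps) rho)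
  (theta_eps_indep : indep_pair P theta eps)
  (Y_def : forall w, Y w = h (theta w) + eps w).

Let prior := distribution P theta.
Let rho0 x : 0 <= rho x. Proof. by case: eps_density. Qed.
Let mrho : measurable_fun setT rho. Proof. by case: eps_density. Qed.

(** A translate of the noise has the translated density. The indicator stays inside an integral over
    the whole space, ready for an exchange of integrals. *)
Lemma translated_density (a : 'rV[R]_k) (A : set 'rV[R]_k) : measurable A ->
  distribution P eps ((+%R a) @^-1` A) =
  (\int[lebesgue_rV R k]_y ((rho (y - a))%:E * (\1_A y)%:E))%E.
Proof.
move=> mA; have mpA : measurable ((+%R a) @^-1` A).
  by rewrite -[X in measurable X]setTI; exact: measurable_rV_add.
case: eps_density => _ _ -> //.
pose am : {mfun 'rV[R]_k >-> 'rV[R]_k} :=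
  HB.pack (+%R a) (isMeasurableFun.Build _ _ _ _ _ (measurable_rV_add a)).
have mf : measurable_fun setT (fun y : 'rV[R]_k => (rho (y - a))%:E).
  apply/measurable_EFinP; apply: (measurableT_comp mrho).
  exact: measurable_rV_sub.
transitivity (\int[lebesgue_rV R k]_(y in A) (rho (y - a))%:E)%E; last first.
  rewrite integral_mkcond; apply: eq_integral => y _.
  rewrite patchE indicE; case: ifP => _; first by rewrite mule1.
  by rewrite mule0.
transitivity (\int[pushforward (lebesgue_rV R k) am]_(y in A) (rho (y - a))%:E)%E.
  rewrite ge0_integral_pushforward//.
  - by apply: eq_integral => x _ /=; rewrite addrC addKr.
  - exact: measurable_funTS.
  - by move=> y _; rewrite lee_fin; exact: rho0.
apply: eq_measure_integral => B mB _; exact: lebesgue_rV_addr.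
Qed.

(** The evidence before [fine], which sends [+oo] to 0: both values 0 and [+oo] must be excluded
    almost surely. *)
Let E y := (\int[prior]_t (likelihood rho h y t)%:E)%E.

Let mE : measurable_fun setT E.
Proof.
apply: (measurable_fun_integral2 prior
  (phi := fun y t => (likelihood rho h y t)%:E)) => //.
  by apply/measurable_EFinP; exact: measurable_likelihood.
by move=> y t; rewrite lee_fin; exact: rho0.
Qed.

(** Given the value t of theta, Y is the noise translated by [h t]; [translated_density] is
    integrated over the prior and the integrals are exchanged. *)
Lemma observation_density A : measurable A ->
  distribution P Y A = (\int[lebesgue_rV R k]_(y in A) E y)%E.
Proof.
move=> mA.
pose g (te : 'rV[R]_s * 'rV[R]_k) := (\1_A (h te.1 + te.2))%:E : \bar R.
have mg : measurable_fun setT g.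
  apply/measurable_EFinP; apply: measurableT_comp; first exact: measurable_indic.
  rewrite (_ : (fun _ => _) = (fun te : 'rV[R]_s * 'rV[R]_k => h te.1 - (0 - te.2))).
    apply: measurable_rV_sub; first exact: measurableT_comp.
    exact: measurable_rV_sub.
  by apply/funext => te; rewrite sub0r opprK.
have g0 te : (0 <= g te)%E by rewrite lee_fin.
transitivity (\int[P]_w g (theta w, eps w))%E.
  rewrite /g /= /distribution /pushforward -[in LHS](setIT (Y @^-1` A)).
  rewrite -integral_indic//; last exact: measurable_funPTI.
  by apply: eq_integral => w _; rewrite /= -Y_def !indicE.
rewrite (indep_pair_integral theta_eps_indep mg g0).
transitivity (\int[prior]_t \int[lebesgue_rV R k]_y ((rho (y - h t))%:E * (\1_A y)%:E))%E.
  pose G t := (\int[distribution P eps]_e g (t, e))%E.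
  transitivity (\int[P]_w (G \o theta) w)%E; first by [].
  rewrite -ge0_integral_distribution; last 2 first.
  - by apply: (measurable_fun_integral2 (distribution P eps)
      (phi := fun t e => g (t, e))) => //; rewrite (_ : (fun _ => _) = g)//;
      apply/funext => -[].
  - by move=> t; exact: integral_ge0.
  apply: eq_integral => t _; rewrite -translated_density//.
  rewrite /G /g /= -[in RHS](setIT (_ @^-1` A)) -integral_indic//.
  by rewrite -[X in measurable X]setTI; exact: measurable_rV_add.
pose F (ty : 'rV[R]_s * 'rV[R]_k) : \bar R :=
  ((rho (ty.2 - h ty.1))%:E * (\1_A ty.2)%:E)%E.
have mF : measurable_fun setT F.
  apply: emeasurable_funM; apply/measurable_EFinP; last first.
    by apply: measurableT_comp; [exact: measurable_indic|].
  apply: (measurableT_comp mrho); apply: measurable_rV_sub => //.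
  exact: measurableT_comp.
have F0 ty : (0 <= F ty)%E by rewrite mule_ge0// lee_fin.
transitivity (\int[lebesgue_rV R k]_y \int[prior]_t F (t, y))%E.
  exact: (fubini_tonelli (m1 := prior) (m2 := lebesgue_rV R k) F mF F0).
rewrite [RHS]integral_mkcond; apply: eq_integral => y _.
rewrite patchE /F /= indicE; case: ifP => _.
  by apply: eq_integral => t _; rewrite mule1.
by rewrite integral0_eq// => t _; rewrite mule0.
Qed.

Lemma evidence_gt0_ae : distribution P Y (~` Y_domain prior rho h) = 0%E.
Proof.
have E0 y : (0 <= E y)%E by apply: integral_ge0 => t _; rewrite lee_fin; exact: rho0.
have evE y : evidence prior rho h y = fine (E y) by rewrite /evidence unlock.
have mEs c : measurable (E @^-1` [set c]).
  by rewrite -[X in measurable X]setTI; apply: mE.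
have -> : ~` Y_domain prior rho h = E @^-1` [set 0%E] `|` E @^-1` [set +oo%E].
  apply/seteqP; split => y; rewrite /Y_domain /= evE; have := E0 y.
    case: (E y) => [r| |] //=; last by right.
    by rewrite lee_fin le_eqVlt => /predU1P[<-|//]; left.
  by move=> _ [->|->] /=; rewrite ltxx.
have A0 : distribution P Y (E @^-1` [set 0%E]) = 0%E.
  by rewrite observation_density// integral0_eq.
apply/eqP; rewrite eq_le measure_ge0 andbT.
apply: (le_trans (measureU2 _ _ _)) => //.
rewrite [X in (X + _)%E](_ : _ = 0%E); last exact: A0.
rewrite add0e.
have Eoo : distribution P Y (E @^-1` [set +oo%E]) =
    (+oo * lebesgue_rV R k (E @^-1` [set +oo%E]))%E.
  rewrite observation_density// -integral_cst//.
  by apply: eq_integral => y; rewrite inE => ->.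
(* Where [E] is infinite the law of Y has density [+oo]; total mass 1 forces this set to be
   Lebesgue-null, hence null for the law. *)
have : (+oo * lebesgue_rV R k (E @^-1` [set +oo%E]) <= 1)%E.
  by rewrite -Eoo; exact: probability_le1.
have [L0 _|L0] := eqVneq (lebesgue_rV R k (E @^-1` [set +oo%E])) 0%E.
  by rewrite -[leLHS]/(distribution P Y _) Eoo L0 mule0.
by rewrite gt0_mulye ?lt0e ?L0 ?measure_ge0.
Qed.

End observation_density.

(** * Distance to the decision manifold *)

Section distance_measurability.
Context (R : realType) (n : nat) (N : 'rV[R]_n -> R).
Hypothesis N_norm : is_norm N.

Lemma is_norm0 : N 0 = 0.
Proof. by case: N_norm => _ + _ => /(_ 0 0); rewrite scale0r normr0 mul0r. Qed.

Lemma is_norm_ge0 v : 0 <= N v.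
Proof.
case: N_norm => tri hom _.
have := tri v (- v); rewrite subrr is_norm0 -scaleN1r hom normrN1 mul1r.
lra.
Qed.

(** Expansion in the canonical basis, [C] being the sum of the norms of its vectors. This compares
    the arbitrary norm with the coordinates, which generate the sigma-algebra. *)
Lemma is_norm_le_sup : exists2 C : R, 0 <= C &
  forall (v : 'rV[R]_n) delta, (forall i, `|v ord0 i| <= delta) -> N v <= C * delta.
Proof.
case: N_norm => tri hom _.
exists (\sum_i N (delta_mx ord0 i)).
  by apply: sumr_ge0 => i _; exact: is_norm_ge0.
move=> v delta vd; rewrite [v in N v]row_sum_delta.
apply: (@le_trans _ _ (\sum_i N (v ord0 i *: delta_mx ord0 i))).
  apply: (big_ind2 (fun x y => N x <= y)) => //; first by rewrite is_norm0.
  by move=> x1 y1 x2 y2 h1 h2; rewrite (le_trans (tri _ _))// lerD.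
rewrite mulr_suml; apply: ler_sum => i _; rewrite hom mulrC.
by rewrite ler_wpM2l ?is_norm_ge0.
Qed.

Lemma dist_to_le (K : set 'rV[R]_n) y v :
  (dist_to N K y <= dist_to N K v + (N (y - v))%:E)%E.
Proof.
rewrite -leeBlDr//; apply: le_ereal_inf_tmp => _ [z Kz <-].
rewrite leeBlDr//; apply: (@le_trans _ _ (N (y - z))%:E).
  by apply: ereal_inf_lbound; exists z.
case: N_norm => tri _ _.
by rewrite -EFinD lee_fin (_ : y - z = (v - z) + (y - v)) ?tri// [RHS]addrC subrKA.
Qed.

(** The set is a countable intersection, over delta = 1/(j+1), of countable unions of coordinate
    boxes of radius delta around the rational points at distance at most r + C delta from K. A point
    of such a box is within r + 2 C delta of K, which tends to r. *)
Lemma measurable_dist_to_le (K : set 'rV[R]_n) (r : R) :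
  measurable [set y | (dist_to N K y <= r%:E)%E].
Proof.
have [C C0 NC] := is_norm_le_sup.
pose ratv (q : 'rV[rat]_n) : 'rV[R]_n := \row_i ratr (q ord0 i).
pose box (q : 'rV[rat]_n) (d : R) : set 'rV[R]_n :=
  [set y | forall i, `|y ord0 i - ratv q ord0 i| <= d].
have mbox q d : measurable (box q d).
  rewrite (_ : box q d = \bigcap_(i in [set: 'I_n])
      (rV_coord i @^-1` [set x | `|x - ratv q ord0 i| <= d])).
    apply: fin_bigcap_measurable => // i _.
    rewrite -[X in measurable X]setTI; apply: measurable_rV_coord => //.
    rewrite (_ : [set x | _] = `[ratv q ord0 i - d, ratv q ord0 i + d]%classic)//.
    apply/seteqP; split => x /=; rewrite in_itv/= ler_norml.
      by move=> /andP[a b]; apply/andP; split; lra.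
    by move=> /andP[a b]; apply/andP; split; lra.
  by apply/seteqP; split=> [y By i _|y By i]; exact: By.
pose c (j : nat) : R := j.+1%:R^-1.
have c0 j : 0 < c j by rewrite invr_gt0.
have -> : [set y | (dist_to N K y <= r%:E)%E] = \bigcap_j \bigcup_q
    (if pselect (dist_to N K (ratv q) <= (r + C * c j)%:E)%E then box q (c j) else set0).
  apply/seteqP; split => [y /= yr j _|y yr /=].
    have q_ i : {q : rat | `|y ord0 i - ratr q| <= c j}.
      apply/cid; have : y ord0 i - c j < y ord0 i + c j by have := c0 j; lra.
      move=> /rat_in_itvoo[q]; rewrite in_itv/= => /andP[a b]; exists q.
      by rewrite ler_norml; apply/andP; split; lra.
    pose q : 'rV[rat]_n := \row_i sval (q_ i).
    have qy i : `|y ord0 i - ratv q ord0 i| <= c j by rewrite !mxE; exact: svalP (q_ i).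
    exists q => //; case: pselect => //=; case.
    apply: (le_trans (dist_to_le _ _ y)); rewrite EFinD leeD// lee_fin.
    by apply: NC => i; rewrite !mxE distrC; have := qy i; rewrite !mxE.
  apply/lee_addgt0Pr => e e0.
  have [j je] : exists j, 2 * C * c j <= e.
    have [C00|C00] := eqVneq C 0; first by exists 0%N; rewrite C00 mulr0 mul0r ltW.
    have C1 : 0 < 2 * C by rewrite mulr_gt0// lt_neqAle eq_sym C00.
    have e2 : 0 < e / (2 * C) by rewrite divr_gt0.
    have [j] := ltr_add_invr e2.
    rewrite add0r => /ltW je; exists j.
    by rewrite mulrC -ler_pdivlMr.
  have [q _] := yr j Logic.I.
  case: pselect => //= qr qy.
  apply: (le_trans (dist_to_le _ _ (ratv q))).
  apply: (@le_trans _ _ ((r + C * c j)%:E + (C * c j)%:E)%E).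
    rewrite leeD// lee_fin; apply: NC => i; rewrite !mxE; have := qy i.
    by rewrite mxE.
  rewrite -!EFinD lee_fin; lra.
apply: bigcap_measurable => [|j _]; first by exists 0%N.
apply: countable_bigcupT_measurable => [|q]; first exact: countableP.
case: pselect => a /=; [exact: mbox|exact: measurable0].
Qed.

End distance_measurability.

(** * Antithetic differences and rates *)

Section max_over_theory.
Context {R : realType} {D : finType}.
Implicit Types (x y : D -> R).

Lemma max_over_ge (d0 : D) x d : x d <= max_over d0 x.
Proof. exact: le_bigmax. Qed.

Lemma max_over_leP (d0 : D) x c : (forall d, x d <= c) -> max_over d0 x <= c.
Proof. by move=> xc; apply: bigmax_le. Qed.

Lemma max_over_argmax (d0 : D) x (d1 : D) : (forall d, x d <= x d1) -> max_over d0 x = x d1.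
Proof. by move=> x1; apply/eqP; rewrite eq_le max_over_ge max_over_leP. Qed.

Lemma max_over_dist (d0 : D) x y m :
  (forall d, `|x d - y d| <= m) -> `|max_over d0 x - max_over d0 y| <= m.
Proof.
move=> xym; rewrite ler_distl; apply/andP; split.
  rewrite lerBlDr; apply: max_over_leP => d.
  have := xym d; rewrite ler_distl => /andP[+ _]; rewrite lerBlDr => /le_trans; apply.
  by rewrite lerD2r max_over_ge.
apply: max_over_leP => d; have := xym d; rewrite ler_distl => /andP[_ /le_trans]; apply.
by rewrite lerD2r max_over_ge.
Qed.

Lemma measurable_max_over (d : measure_display) (T : measurableType d) (d0 : D)
    (x : D -> T -> R) :
  (forall d, measurable_fun setT (x d)) ->
  measurable_fun setT (fun w => max_over d0 (x ^~ w)).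
Proof.
move=> mx; rewrite /max_over.
elim: (index_enum D) => [|d1 s IH].
  under eq_fun do rewrite big_nil.
  exact: mx.
under eq_fun do rewrite big_cons.
by apply: measurable_maxr.
Qed.

End max_over_theory.

Section antithetic_difference.
Context {R : realType} {D : finType}.

(* [(g - G) * (1 + q)] is linear in the samples, hence is the mean of its two
   antithetic counterparts; only the quadratic remainder [(g - G) * q] survives. *)
Lemma antithetic_mean_le (G g ga gb q qa qb m e : R) :
  (g - G) * (1 + q) = 2^-1 * ((ga - G) * (1 + qa) + (gb - G) * (1 + qb)) ->
  `|g - G| <= m -> `|ga - G| <= m -> `|gb - G| <= m ->
  `|q| <= e -> `|qa| <= e -> `|qb| <= e ->
  `|g - 2^-1 * (ga + gb)| <= 2 * (m * e).
Proof.
move=> lin gm gam gbm qe qae qbe.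
have -> : g - 2^-1 * (ga + gb) =
    - ((g - G) * q) + 2^-1 * ((ga - G) * qa) + 2^-1 * ((gb - G) * qb).
  have : (g - G) * (1 + q) - 2^-1 * ((ga - G) * (1 + qa) + (gb - G) * (1 + qb)) = 0.
    by rewrite lin subrr.
  by move=> h; lra.
have prod x y : `|x| <= m -> `|y| <= e -> `|x * y| <= m * e.
  by move=> xm ye; rewrite normrM ler_pM.
have := prod _ _ gm qe; have := prod _ _ gam qae; have := prod _ _ gbm qbe.
rewrite !ler_norml => /andP[? ?] /andP[? ?] /andP[? ?].
by apply/andP; split; lra.
Qed.

(** If [dopt] maximises all three estimators, the maxima are its components and [antithetic_mean_le]
    applies to them. Otherwise some estimator prefers another [d], which errors of size [m] allow
    only for a true gap of at most [2 * m]; each maximum is still within [m] of the true one, the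
    maximum being 1-Lipschitz. *)
Lemma antithetic_max_le (d0 dopt : D) (G g ga gb : D -> R)
    (Gm gm gma gmb q qa qb m e : R) :
  (forall d, (g d - G d) * (1 + q) =
     2^-1 * ((ga d - G d) * (1 + qa) + (gb d - G d) * (1 + qb))) ->
  (gm - Gm) * (1 + q) = 2^-1 * ((gma - Gm) * (1 + qa) + (gmb - Gm) * (1 + qb)) ->
  (forall d, `|g d - G d| <= m) -> (forall d, `|ga d - G d| <= m) ->
  (forall d, `|gb d - G d| <= m) ->
  `|gm - Gm| <= m -> `|gma - Gm| <= m -> `|gmb - Gm| <= m ->
  `|q| <= e -> `|qa| <= e -> `|qb| <= e ->
  let Delta := gm - max_over d0 g - 2^-1 * (gma + gmb)
    + 2^-1 * (max_over d0 ga + max_over d0 gb) in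
  `|Delta| <= 4 * (m * e) \/
  (`|Delta| <= 2 * (m * e) + 2 * m /\
   exists2 d, d != dopt & G dopt - G d <= 2 * m).
Proof.
move=> lin linm hg hga hgb hm hma hmb hq hqa hqb Delta.
have T1 : `|gm - 2^-1 * (gma + gmb)| <= 2 * (m * e).
  exact: (antithetic_mean_le linm).
pose T2 := max_over d0 g - 2^-1 * (max_over d0 ga + max_over d0 gb).
have DeltaE : Delta = (gm - 2^-1 * (gma + gmb)) - T2 by rewrite /Delta /T2; lra.
have [opt|nopt] := pselect (forall d,
    [/\ g d <= g dopt, ga d <= ga dopt & gb d <= gb dopt]).
  left; have T2e : `|T2| <= 2 * (m * e).
    rewrite /T2 !(@max_over_argmax _ _ _ _ dopt); try by move=> d; case: (opt d).
    exact: (antithetic_mean_le (lin dopt)).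
  by rewrite DeltaE (le_trans (ler_normB _ _))//; lra.
right; split.
  have := max_over_dist d0 hg; have := max_over_dist d0 hga.
  have := max_over_dist d0 hgb; move: T1.
  rewrite DeltaE /T2 !ler_norml.
  by move=> /andP[? ?] /andP[? ?] /andP[? ?] /andP[? ?]; apply/andP; split; lra.
move/existsNP : nopt => [d nd].
have wrong (x : D -> R) : (forall d, `|x d - G d| <= m) -> ~ x d <= x dopt ->
    exists2 d, d != dopt & G dopt - G d <= 2 * m.
  move=> hx /negP; rewrite -ltNge => xd; exists d.
    by apply: contraTneq xd => ->; rewrite ltxx.
  have := hx d; have := hx dopt; rewrite !ler_norml => /andP[? ?] /andP[? ?]; lra.
have [h1|h1] := pselect (g d <= g dopt); last exact: wrong h1.
have [h2|h2] := pselect (ga d <= ga dopt); last exact: wrong h2.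
have [h3|h3] := pselect (gb d <= gb dopt); last exact: wrong h3.
by case: nd.
Qed.

End antithetic_difference.

(** * Trading powers of the error for powers of the sample size *)

Section rates.
Context {R : realType}.
Variables (p q M : R).
Hypotheses (p2 : 2 <= p) (q1 : 1 <= q) (qp : q <= p) (M1 : 1 < M).

(** At q = 2 and q = 1 these are the exponents 3p/(2p+2) and p/(p+1) of the two claims. *)
Let kappa := p * (q + 1) / (2 * (p + 1)).
Let r := M `^ (- (p / (2 * p + 2))).
Let U e := M `^ (p / 2) * e `^ p.

Let M0 : 0 < M. Proof. exact: lt_trans M1. Qed.
Let U_ge0 e : 0 <= U e. Proof. by rewrite mulr_ge0// powR_ge0. Qed.
Let r_gt0 : 0 < r. Proof. exact: powR_gt0. Qed.

Lemma le0_powR_le (a x y : R) : a <= 0 -> 0 < x -> x <= y -> y `^ a <= x `^ a.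
Proof.
move=> a0 x0 xy; have y0 : 0 < y by exact: lt_le_trans xy.
rewrite -[a]opprK (powRN y (- a)) (powRN x (- a)) lef_pV2 ?posrE ?powR_gt0//.
by apply: ge0_ler_powR; rewrite ?oppr_ge0// nnegrE ltW.
Qed.

Let powU e (a : R) : 0 <= e -> e `^ (a * p) = M `^ (- (a * p / 2)) * U e `^ a.
Proof.
move=> e0; rewrite /U powRM ?powR_ge0// -!powRrM mulrA -powRD; last first.
  by rewrite (gt_eqF M0) implybT.
rewrite (_ : _ + _ = 0); last by field.
by rewrite powRr0 mul1r mulrC.
Qed.

(** The exponent 2 kappa lies between q and min(2q, p): the bounds q and 2q give the majorant e^(2
    kappa) on either side of e = 1, and the bound p makes the resulting power of [U] at most the
    first. *)
Lemma quadratic_rate e : 0 <= e ->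
  (e * Num.min 1 e) `^ q <= M `^ (- kappa) * (1 + U e).
Proof.
move: p2 q1 qp => p2' q1' qp' e0.
have k1 : q <= 2 * kappa.
  by rewrite /kappa mulrA ler_pdivlMr; [nra|lra].
have k2 : 2 * kappa <= 2 * q.
  by rewrite ler_pM2l// /kappa ler_pdivrMr; [nra|lra].
have k3 : 2 * kappa <= p.
  by rewrite /kappa mulrA ler_pdivrMr; [nra|lra].
have k0 : 0 < 2 * kappa by lra.
apply: (@le_trans _ _ (e `^ (2 * kappa))).
  have [e1|e1] := leP 1 e.
    by rewrite mulr1; apply: ler_powR.
  rewrite -expr2 -powR_mulrn// -powRrM.
  move: e0; rewrite le_eqVlt => /predU1P[<-|e0].
    by rewrite !powR0// gt_eqF//; lra.
  by apply: ger_powR => //; rewrite e0 ltW.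
have -> : e `^ (2 * kappa) = M `^ (- kappa) * U e `^ (2 * kappa / p).
  rewrite -[in LHS](@divfK _ p _ (2 * kappa)); last by rewrite gt_eqF//; lra.
  rewrite powU//; congr (_ `^ _ * _); rewrite divfK; last by rewrite gt_eqF//; lra.
  by lra.
rewrite ler_wpM2l ?powR_ge0//.
have [U1|U1] := leP (U e) 1.
  apply: (@le_trans _ _ 1); last by rewrite lerDl.
  rewrite -[leRHS](@powRr0 _ 1) powRr0 -[leRHS]/((fun=> 1) (2 * kappa / p)) -powR1.
  by apply: ge0_ler_powR; rewrite ?nnegrE// divr_ge0//; lra.
apply: (@le_trans _ _ (U e)); last by rewrite lerDr.
rewrite -[leRHS]powRr1//; apply: ler_powR; first exact: ltW.
by rewrite ler_pdivrMr ?mul1r//; lra.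
Qed.

(** A pointwise substitute for Hölder's inequality: with W = U + 1/r, U^(q/p) <= W W^(q/p - 1) <= W
    r^(1 - q/p), because W >= 1/r and q <= p. *)
Lemma near_rate e : 0 <= e -> e `^ q <= M `^ (- kappa) * (U e + r^-1).
Proof.
move: p2 q1 qp => p2' q1' qp' e0; have p0 : p != 0 by rewrite gt_eqF//; lra.
set W := U e + r^-1.
have rW : r^-1 <= W by rewrite lerDr.
have rV : 0 < r^-1 by rewrite invr_gt0.
have W0 : 0 < W by exact: lt_le_trans rW.
have -> : e `^ q = M `^ (- (q / 2)) * U e `^ (q / p).
  by rewrite -[in LHS](divfK p0 q) powU// divfK.
have UW : U e `^ (q / p) <= W * r `^ (1 - q / p).
  apply: (@le_trans _ _ (W `^ (q / p))).
    by apply: ge0_ler_powR; rewrite ?nnegrE ?divr_ge0 ?lerDl ?(ltW rV)//; lra.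
  have -> : W `^ (q / p) = W * W `^ (q / p - 1).
    rewrite mulr_powRB1//; first exact: ltW.
    by rewrite divr_gt0//; lra.
  rewrite ler_wpM2l ?(ltW W0)//.
  have -> : r `^ (1 - q / p) = r^-1 `^ (q / p - 1).
    by rewrite -(powR_inv1 (ltW r_gt0)) -powRrM; congr (_ `^ _); lra.
  apply: le0_powR_le => //.
  by rewrite subr_le0 ler_pdivrMr ?mul1r//; lra.
apply: (le_trans (ler_wpM2l (powR_ge0 _ _) UW)).
rewrite mulrCA mulrC ler_wpM2r ?(ltW W0)//.
rewrite /r -powRrM -powRD; last by rewrite (gt_eqF M0) implybT.
rewrite (_ : _ + _ = - kappa)// /kappa; field.
by rewrite p0 /= ?gt_eqF//; lra.
Qed.

(** As in Markov's inequality, e^q = e^p e^(q-p) <= e^p (cr)^(q-p). *)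
Lemma far_rate e c : 0 < c -> c * r <= e ->
  e `^ q <= c `^ (q - p) * (M `^ (- kappa) * U e).
Proof.
move: p2 q1 qp => p2' q1' qp' c0 cre.
have cr0 : 0 < c * r by exact: mulr_gt0.
have e0 : 0 < e by exact: lt_le_trans cre.
have -> : e `^ q = e `^ (1 * p) * e `^ (q - p).
  by rewrite mul1r -powRD ?(gt_eqF e0) ?implybT//; congr (_ `^ _); lra.
rewrite powU ?(ltW e0)// powRr1//.
apply: (@le_trans _ _ (M `^ (- (1 * p / 2)) * U e * (c * r) `^ (q - p))).
  by rewrite ler_wpM2l ?mulr_ge0 ?powR_ge0// le0_powR_le//; lra.
rewrite powRM ?(ltW c0) ?(ltW r_gt0)// [leLHS]mulrCA ler_wpM2l ?powR_ge0//.
rewrite mulrAC ler_wpM2r//.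
rewrite /r -powRrM -powRD; last by rewrite (gt_eqF M0) implybT.
rewrite (_ : _ + _ = - kappa)// /kappa; field.
by rewrite ?gt_eqF//; lra.
Qed.

Lemma pointwise_rate (Delta A c e : R) (near : bool) :
  0 <= e -> 0 < A -> 0 < c ->
  `|Delta| <= A * (e * Num.min 1 e) \/
    (`|Delta| <= A * e /\ (near \/ c * r <= e)) ->
  `|Delta| `^ q <= A `^ q * (1 + c `^ (q - p)) * M `^ (- kappa) *
     (1 + U e + near%:R * r^-1).
Proof.
move=> e0 A0 c0 Dle.
have q0 : 0 <= q by exact: le_trans q1.
have K0 : 0 <= c `^ (q - p) by exact: powR_ge0.
have V0 : 0 <= near%:R * r^-1 by rewrite mulr_ge0// invr_ge0 ltW.
have Mk : 0 <= M `^ (- kappa) by exact: powR_ge0.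
have main x : 0 <= x -> `|Delta| <= A * x ->
    x `^ q <= (1 + c `^ (q - p)) * (M `^ (- kappa) * (1 + U e + near%:R * r^-1)) ->
    `|Delta| `^ q <= A `^ q * (1 + c `^ (q - p)) * M `^ (- kappa) *
     (1 + U e + near%:R * r^-1).
  move=> x0 DA xq; apply: (@le_trans _ _ ((A * x) `^ q)).
    by apply: ge0_ler_powR; rewrite ?nnegrE// mulr_ge0// ltW.
  rewrite powRM//; last exact: ltW.
  by rewrite -!mulrA ler_wpM2l ?powR_ge0.
have MU : 0 <= M `^ (- kappa) * U e by rewrite mulr_ge0.
have MV : 0 <= M `^ (- kappa) * (near%:R * r^-1) by rewrite mulr_ge0.
have S0 : 0 <= M `^ (- kappa) * (1 + U e + near%:R * r^-1).
  by rewrite mulr_ge0// !addr_ge0.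
case: Dle => [Dle|[Dle [nr|far]]].
- apply: main Dle _; first by rewrite mulr_ge0// le_min e0 ler01.
  apply: (le_trans (quadratic_rate e0)).
  apply: (@le_trans _ _ (1 * (M `^ (- kappa) * (1 + U e + near%:R * r^-1)))).
    by rewrite mul1r ler_wpM2l// lerDl.
  by rewrite ler_wpM2r// lerDl.
- apply: main Dle _ => //; apply: (le_trans (near_rate e0)).
  apply: (@le_trans _ _ (1 * (M `^ (- kappa) * (1 + U e + near%:R * r^-1)))).
    by rewrite mul1r ler_wpM2l// nr mul1r -addrA lerDr.
  by rewrite ler_wpM2r// lerDl.
- apply: main Dle _ => //; apply: (le_trans (far_rate c0 far)).
  apply: (@le_trans _ _ (c `^ (q - p) * (M `^ (- kappa) * (1 + U e + near%:R * r^-1)))).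
    by rewrite ler_wpM2l// ler_wpM2l// addrAC lerDr addr_ge0.
  by rewrite ler_wpM2r// lerDr.
Qed.

End rates.

(** * Posterior means and their estimators *)

(** The product of x and |x|^(-2) is the inverse, also at 0 where both vanish. *)
Lemma measurable_invr (R : realType) : measurable_fun setT (fun x : R => x^-1).
Proof.
rewrite (_ : (fun _ => _) = (fun x : R => x * (`|x| `^ (-1) * `|x| `^ (-1)))).
  have m : measurable_fun setT (fun x : R => `|x| `^ (-1)).
    exact: (measurableT_comp (measurable_powR _) (@normr_measurable R setT)).
  by apply: measurable_funM => //; exact: measurable_funM.
apply/funext => x; rewrite powR_inv1// -invfM -expr2 real_normK ?num_real//.
have [->|x0] := eqVneq x 0; first by rewrite invr0 mul0r.
by field.
Qed.

Lemma measurable_fun_integral2_signed d1 d2 (T1 : measurableType d1)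
    (T2 : measurableType d2) (R : realType)
    (mu : {sigma_finite_measure set T2 -> \bar R}) (phi : T1 -> T2 -> \bar R) :
  measurable_fun setT (fun yt : T1 * T2 => phi yt.1 yt.2) ->
  measurable_fun setT (fun y => \int[mu]_t phi y t)%E.
Proof.
move=> mphi; under eq_fun do rewrite integralE.
apply: emeasurable_funB.
  apply: (measurable_fun_integral2 mu (phi := fun y => (phi y)^\+%E)) => //.
  under eq_fun do rewrite funeposE.
  exact: measurable_maxe.
apply: (measurable_fun_integral2 mu (phi := fun y => (phi y)^\-%E)) => //.
under eq_fun do rewrite funenegE.
by apply: measurable_maxe => //; exact: measurableT_comp.
Qed.

Lemma powR_sum_le (R : realType) (J : finType) (x : J -> R) (p : R) :
  0 < p -> (forall j, 0 <= x j) ->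
  (\sum_j x j) `^ p <= #|J|%:R `^ p * \sum_j x j `^ p.
Proof.
move=> p0 x0; have [j0|J0] := pickP (@predT J); last first.
  rewrite big_pred0// powR0 ?gt_eqF// mulr_ge0 ?powR_ge0//.
  by apply: sumr_ge0 => j _; exact: powR_ge0.
move=> _; pose y := max_over j0 x.
have [j1 yE] : exists j1, y = x j1.
  rewrite /y /max_over; elim/big_ind: _; first by exists j0.
    move=> a b [ja ->] [jb ->]; case: (leP (x ja) (x jb)) => _; by [exists jb|exists ja].
  by move=> j _; exists j.
apply: (@le_trans _ _ ((#|J|%:R * x j1) `^ p)).
  apply: ge0_ler_powR; rewrite ?nnegrE ?(ltW p0) ?sumr_ge0 ?mulr_ge0//.
  rewrite mulr_natl -sumr_const; apply: ler_sum => j _.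
  by rewrite -yE; exact: max_over_ge.
rewrite powRM// ler_wpM2l ?powR_ge0// (bigD1 j1)//= lerDl.
by apply: sumr_ge0 => j _; exact: powR_ge0.
Qed.

Lemma powRD1_le (R : realType) (p x : R) : 0 < p -> 0 <= x ->
  (x + 1) `^ p <= 2 `^ p * (x `^ p + 1).
Proof.
move=> p0 x0.
have := @powR_sum_le R bool (fun b => if b then x else 1) p p0 _.
by rewrite !big_bool/= card_bool powR1; apply => -[].
Qed.

Section posterior.
Context {R : realType} {s k : nat}.
Variables (prior : probability 'rV[R]_s R) (rho : 'rV[R]_k -> R)
  (h : 'rV[R]_s -> 'rV[R]_k).
Hypotheses (rho0 : forall x, 0 <= rho x)
  (mrho : measurable_fun setT rho) (mh : measurable_fun setT h).

Local Notation lik := (likelihood rho h).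
Local Notation ev := (evidence prior rho h).

Let mlik : measurable_fun setT (fun yt : 'rV[R]_k * 'rV[R]_s => lik yt.1 yt.2).
Proof. exact: measurable_likelihood. Qed.

Let mliky y : measurable_fun setT (lik y).
Proof.
by apply: (measurable_fun_comp2 (phi := lik) (f := fun=> y) (g := id) mlik).
Qed.

Let lik0 y t : 0 <= lik y t. Proof. exact: rho0. Qed.

Lemma evidenceE y : ev y = fine (\int[prior]_t (lik y t)%:E)%E.
Proof. by rewrite /evidence unlock. Qed.

Lemma evidence_ge0 y : 0 <= ev y.
Proof. by rewrite evidenceE fine_ge0// integral_ge0// => t _; rewrite lee_fin. Qed.

Lemma measurable_evidence : measurable_fun setT ev.
Proof.
rewrite (_ : ev = (fun y => fine (\int[prior]_t (lik y t)%:E)%E)); last first.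
  by apply/funext => y; exact: evidenceE.
apply: measurableT_comp => //.
apply: (measurable_fun_integral2 prior (phi := fun y t => (lik y t)%:E)).
  exact/measurable_EFinP.
by move=> y t; rewrite lee_fin.
Qed.

Lemma measurable_Y_domain : measurable (Y_domain prior rho h).
Proof.
rewrite (_ : Y_domain _ _ _ = ev @^-1` `]0, +oo[%classic); last first.
  by apply/seteqP; split => y /=; rewrite in_itv/= andbT.
by rewrite -[X in measurable X]setTI; apply: measurable_evidence.
Qed.

Lemma integrable_likelihood y : 0 < ev y ->
  prior.-integrable setT (EFin \o lik y).
Proof.
rewrite evidenceE => e0; apply/integrableP; split; first exact/measurable_EFinP.
under eq_integral do rewrite /= ger0_norm//.
by move: e0; case: (integral _ _ _) => [r| |] /=; rewrite ?ltxx ?ltry.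
Qed.

Variables (phi : 'rV[R]_s -> R) (B : R).
Hypotheses (mphi : measurable_fun setT phi) (phiB : forall t, `|phi t| <= B).

Let B0 : 0 <= B. Proof. exact: le_trans (phiB 0). Qed.

(** A general bounded [phi] covers at once the [f d], their maximum and the constant 1 of the
    denominator. *)
Definition posterior_mean y : R := fine 'E_prior[fun t => phi t * lik y t] / ev y.

(* Since [x / 0 = 0], this vanishes where the evidence does. *)
Definition centred y t : R := phi t * lik y t / ev y - posterior_mean y.

Let mphilik : measurable_fun setT
  (fun yt : 'rV[R]_k * 'rV[R]_s => phi yt.2 * lik yt.1 yt.2).
Proof. by apply: measurable_funM => //; exact: measurableT_comp. Qed.

Lemma measurable_posterior_mean : measurable_fun setT posterior_mean.
Proof.
apply: measurable_funM; last first.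
  by apply: (measurableT_comp (@measurable_invr R)); exact: measurable_evidence.
under eq_fun do rewrite unlock.
apply: measurableT_comp => //.
apply: (measurable_fun_integral2_signed prior (phi := fun y t => (phi t * lik y t)%:E)).
exact/measurable_EFinP.
Qed.

Lemma measurable_centred : measurable_fun setT
  (fun yt : 'rV[R]_k * 'rV[R]_s => centred yt.1 yt.2).
Proof.
apply: measurable_funB; last first.
  by apply: measurableT_comp => //; exact: measurable_posterior_mean.
apply: measurable_funM => //; apply: (measurableT_comp (@measurable_invr R)).
by apply: measurableT_comp => //; exact: measurable_evidence.
Qed.

Let iphilik y : 0 < ev y ->
  prior.-integrable setT (fun t => (phi t * lik y t)%:E).
Proof.
move=> e0; apply: (@le_integrable _ _ _ _ _ _ _ (fun t => B%:E * (lik y t)%:E)%E) => //.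
- by apply/measurable_EFinP; apply: measurable_funM.
- move=> t _; rewrite -EFinM !abse_EFin lee_fin !normrM.
  by rewrite ler_wpM2r// (le_trans (phiB t))// ler_norm.
- by apply: integrableZl => //; exact: integrable_likelihood.
Qed.

Lemma posterior_meanE y : 0 < ev y ->
  ((ev y * posterior_mean y)%:E = \int[prior]_t (phi t * lik y t)%:E)%E.
Proof.
move=> e0; rewrite /posterior_mean mulrCA divff ?gt_eqF// mulr1 unlock fineK//.
exact: integrable_fin_num (iphilik e0).
Qed.

Lemma posterior_mean_bound y : `|posterior_mean y| <= B.
Proof.
have [e0|e0] := eqVneq (ev y) 0.
  by rewrite /posterior_mean e0 invr0 mulr0 normr0.
have {}e0 : 0 < ev y by rewrite lt_neqAle eq_sym e0 evidence_ge0.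
rewrite -(ler_pM2l e0) -[X in X * _](gtr0_norm e0) -normrM.
rewrite -lee_fin -abse_EFin posterior_meanE//.
apply: (le_trans (le_abse_integral prior _ _)) => //.
  by apply/measurable_EFinP; apply: measurable_funM.
apply: (@le_trans _ _ (\int[prior]_t (B%:E * (lik y t)%:E))%E).
  apply: ge0_le_integral => //.
  - by do 2 apply: measurableT_comp => //; apply: measurable_funM.
  - by apply: measurable_funeM; exact/measurable_EFinP.
  - by move=> t _; rewrite -EFinM lee_fin normrM (ger0_norm (lik0 _ _)) ler_wpM2r.
rewrite ge0_integralZl//; last 2 first.
- exact/measurable_EFinP.
- by move=> t _; rewrite lee_fin.
rewrite mulrC EFinM evidenceE fineK//.
exact: integrable_fin_num (integrable_likelihood e0).
Qed.

Lemma centred0 y t : ev y = 0 -> centred y t = 0.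
Proof. by move=> e0; rewrite /centred /posterior_mean e0 invr0 !mulr0 subrr. Qed.

(** Stated for every [y], as the moment inequality requires; where the evidence vanishes, [centred]
    is identically 0. *)
Lemma integrable_centred y :
  prior.-integrable setT (EFin \o centred y) /\ (\int[prior]_t (centred y t)%:E = 0)%E.
Proof.
have [e0|e0] := eqVneq (ev y) 0.
  have cE : EFin \o centred y = cst 0%E by apply/funext => t /=; rewrite centred0.
  split; first by rewrite cE; exact: integrable0.
  by rewrite -[LHS]/(\int[prior]_t (EFin \o centred y) t)%E cE integral0.
have {}e0 : 0 < ev y by rewrite lt_neqAle eq_sym e0 evidence_ge0.
have i1 : prior.-integrable setT (fun t => ((ev y)^-1)%:E * (phi t * lik y t)%:E)%E.
  by apply: integrableZl => //; exact: iphilik.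
have i2 : prior.-integrable setT (cst (- posterior_mean y)%:E).
  exact: finite_measure_integrable_cst.
have cE : EFin \o centred y =
    (fun t => ((ev y)^-1)%:E * (phi t * lik y t)%:E + (- posterior_mean y)%:E)%E.
  by apply/funext => t /=; rewrite -EFinM -EFinD mulrC.
split; first by rewrite cE; exact: integrableD.
rewrite -[LHS]/(\int[prior]_t (EFin \o centred y) t)%E cE integralD//.
rewrite integralZl//; last exact: iphilik.
rewrite integral_cst// [X in (_ + _ * X)%E]probability_setT mule1.
by rewrite -posterior_meanE// -EFinM -EFinD mulrA mulVf ?gt_eqF// mul1r subrr.
Qed.

Lemma centred_bound y t : `|centred y t| <= B * (lik y t / ev y + 1).
Proof.
apply: (le_trans (ler_normB _ _)); rewrite mulrDr mulr1.
apply: lerD; last exact: posterior_mean_bound.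
rewrite -mulrA normrM [X in _ * X]ger0_norm; last first.
  by rewrite divr_ge0// evidence_ge0.
by rewrite ler_wpM2r// divr_ge0// evidence_ge0.
Qed.

(** Reduces the p-th moment of the centred terms to that of the likelihood ratio, through
    [centred_bound] and (x + 1)^p <= 2^p (x^p + 1). *)
Lemma centred_moment d (Om : measurableType d) (P : probability Om R)
    (Y : {RV P >-> 'rV[R]_k}) (p : R) : 0 < p ->
  (\int[P]_w \int[prior]_t (`|centred (Y w) t| `^ p)%:E <=
   ((2 * B) `^ p)%:E * (\int[distribution P Y]_y \int[prior]_t
     ((lik y t / ev y) `^ p)%:E + 1))%E.
Proof.
move=> p0.
have mr : measurable_fun setT
    (fun yt : 'rV[R]_k * 'rV[R]_s => (lik yt.1 yt.2 / ev yt.1) `^ p).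
  apply: (measurableT_comp (measurable_powR _)); apply: measurable_funM => //.
  apply: (measurableT_comp (@measurable_invr R)).
  by apply: measurableT_comp => //; exact: measurable_evidence.
have mc : measurable_fun setT
    (fun yt : 'rV[R]_k * 'rV[R]_s => `|centred yt.1 yt.2| `^ p).
  apply: (measurableT_comp (measurable_powR _)); apply: measurableT_comp => //.
  exact: measurable_centred.
pose I y := (\int[prior]_t ((lik y t / ev y) `^ p)%:E)%E.
have I0 y : (0 <= I y)%E by apply: integral_ge0 => t _; rewrite lee_fin powR_ge0.
have mI : measurable_fun setT I.
  apply: (measurable_fun_integral2 prior (phi := fun y t => ((lik y t / ev y) `^ p)%:E)).
    exact/measurable_EFinP.
  by move=> y t; rewrite lee_fin powR_ge0.
pose J y := (\int[prior]_t (`|centred y t| `^ p)%:E)%E.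
have J0 y : (0 <= J y)%E by apply: integral_ge0 => t _; rewrite lee_fin powR_ge0.
have mJ : measurable_fun setT J.
  apply: (measurable_fun_integral2 prior (phi := fun y t => (`|centred y t| `^ p)%:E)).
    exact/measurable_EFinP.
  by move=> y t; rewrite lee_fin powR_ge0.
have mcy y : measurable_fun setT (fun t => (`|centred y t| `^ p)%:E).
  apply/measurable_EFinP.
  exact: (measurable_fun_comp2 (phi := fun y t => `|centred y t| `^ p)
    (f := fun=> y) (g := id) mc).
have mry y : measurable_fun setT (fun t => ((lik y t / ev y) `^ p)%:E).
  apply/measurable_EFinP.
  exact: (measurable_fun_comp2 (phi := fun y t => (lik y t / ev y) `^ p)
    (f := fun=> y) (g := id) mr).
have K0 : 0 <= (2 * B) `^ p by exact: powR_ge0.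
have JI y : (J y <= ((2 * B) `^ p)%:E * (I y + 1))%E.
  apply: (@le_trans _ _ (\int[prior]_t (((2 * B) `^ p)%:E *
      (((lik y t / ev y) `^ p)%:E + 1)))%E).
    apply: ge0_le_integral => //.
    - by apply: measurable_funeM; apply: emeasurable_funD.
    - move=> t _; rewrite -EFinD -EFinM lee_fin.
      have r0 : 0 <= lik y t / ev y by rewrite divr_ge0// evidence_ge0.
      apply: (@le_trans _ _ ((B * (lik y t / ev y + 1)) `^ p)).
        apply: ge0_ler_powR; rewrite ?nnegrE ?(ltW p0) ?mulr_ge0 ?addr_ge0//.
        exact: centred_bound.
      rewrite powRM ?addr_ge0// powRM// [leRHS]mulrAC mulrC ler_wpM2r ?powR_ge0//.
      exact: powRD1_le.
  rewrite ge0_integralZl//.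
  - rewrite ge0_integralD//; last by move=> t _; rewrite lee_fin powR_ge0.
    by rewrite integral_cst// [X in (_ + _ * X)%E]probability_setT mule1.
  - by apply: emeasurable_funD.
  - by move=> t _; rewrite adde_ge0// lee_fin powR_ge0.
rewrite -[leLHS]/(\int[P]_w (J \o Y) w)%E.
rewrite -[X in (_ <= _ * (X + _))%E]/(\int[distribution P Y]_y I y)%E.
move: J I J0 I0 JI mJ mI => {mr mc mcy mry} J I J0 I0 JI mJ mI.
have mJY : measurable_fun setT (J \o Y) by exact: measurableT_comp.
have mIY : measurable_fun setT (I \o Y) by exact: measurableT_comp.
rewrite ge0_integral_distribution//.
apply: (@le_trans _ _ (\int[P]_w (((2 * B) `^ p)%:E * ((I \o Y) w + 1)))%E).
  apply: ge0_le_integral => //.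
  - by move=> w _; exact: J0.
  - by apply: measurable_funeM; apply: emeasurable_funD.
  - by move=> w _; exact: JI.
rewrite ge0_integralZl//; last 2 first.
- by apply: emeasurable_funD.
- by move=> w _; rewrite adde_ge0//; exact: I0.
rewrite ge0_integralD//; last by move=> w _; exact: I0.
by rewrite integral_cst// [X in (_ + _ * X)%E]probability_setT mule1.
Qed.

End posterior.

(** * Ratio estimators and their linearisation *)

Section sample_averages.
Context {R : realType} {s k : nat}.
Implicit Types (th : nat -> 'rV[R]_s) (psi : 'rV[R]_s -> R).

Lemma sample_avg_halves th n psi :
  sample_avg th 0 (n + n) psi =
  2^-1 * (sample_avg th 0 n psi + sample_avg th n (n + n) psi).
Proof.
rewrite /sample_avg !subn0 addnK -mulrDr -big_cat_nat ?leq_addr//= mulrA.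
by rewrite -invfM -natrM mul2n addnn.
Qed.

Variables (prior : probability 'rV[R]_s R) (rho : 'rV[R]_k -> R)
  (h : 'rV[R]_s -> 'rV[R]_k).
Hypotheses (rho0 : forall x, 0 <= rho x)
  (mrho : measurable_fun setT rho) (mh : measurable_fun setT h).

Local Notation lik := (likelihood rho h).
Local Notation ev := (evidence prior rho h).
Local Notation centred := (centred prior rho h).
Local Notation posterior_mean := (posterior_mean prior rho h).

Lemma sample_avg_centred th a b phi y : (a < b)%N ->
  sample_avg th a b (centred phi y) =
  sample_avg th a b (fun t => phi t * lik y t) / ev y - posterior_mean phi y.
Proof.
move=> ab; rewrite /sample_avg sumrB -mulr_suml mulrBr mulrA; congr (_ - _).
rewrite sumr_const_nat mulrnAr -[_ *+ _]mulr_natr mulrAC mulVf ?mul1r//.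
by rewrite pnatr_eq0 subn_eq0 -ltnNge.
Qed.

Lemma posterior_mean1 y : 0 < ev y -> posterior_mean (fun=> 1) y = 1.
Proof.
move=> e0; rewrite /posterior_mean (_ : (fun _ => _) = lik y); last first.
  by apply/funext => t; rewrite mul1r.
by rewrite divff// gt_eqF.
Qed.

Lemma sample_avg_lik th a b y : (a < b)%N -> 0 < ev y ->
  sample_avg th a b (lik y) / ev y = 1 + sample_avg th a b (centred (fun=> 1) y).
Proof.
move=> ab e0; rewrite sample_avg_centred// posterior_mean1// addrC subrK.
by congr (sample_avg _ _ _ _ / _); apply/funext => t; rewrite mul1r.
Qed.

Definition ratio_avg phi y th a b : R :=
  sample_avg th a b (fun t => phi t * lik y t) / sample_avg th a b (lik y).

Variables (phi : 'rV[R]_s -> R) (B : R).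
Hypothesis phiB : forall t, `|phi t| <= B.

Let B0 : 0 <= B. Proof. exact: le_trans (phiB 0). Qed.

Let lik0 y t : 0 <= lik y t. Proof. exact: rho0. Qed.

Lemma sample_avg_dominated th a b y :
  `|sample_avg th a b (fun t => phi t * lik y t)| <= B * sample_avg th a b (lik y).
Proof.
rewrite /sample_avg normrM ger0_norm ?invr_ge0// mulrCA ler_wpM2l ?invr_ge0//.
rewrite (le_trans (ler_norm_sum _ _ _))// mulr_sumr; apply: ler_sum => m _.
by rewrite normrM (ger0_norm (lik0 _ _)) ler_wpM2r.
Qed.

Lemma sample_avg_lik_ge0 th a b y : 0 <= sample_avg th a b (lik y).
Proof. by rewrite /sample_avg mulr_ge0 ?invr_ge0// sumr_ge0. Qed.

Lemma ratio_avg_bound y th a b : `|ratio_avg phi y th a b| <= B.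
Proof.
rewrite /ratio_avg; have := sample_avg_lik_ge0 th a b y.
rewrite le_eqVlt => /predU1P[<-|S0]; first by rewrite invr0 mulr0 normr0.
by rewrite normrM normfV (gtr0_norm S0) ler_pdivrMr// sample_avg_dominated.
Qed.

(** A vanishing denominator is no exception: the numerator, dominated by [B] times it, vanishes
    too. *)
Lemma ratio_avgM y th a b : ratio_avg phi y th a b * sample_avg th a b (lik y) =
  sample_avg th a b (fun t => phi t * lik y t).
Proof.
rewrite /ratio_avg.
have [S0|S0] := eqVneq (sample_avg th a b (lik y)) 0; last by rewrite divfK.
have := sample_avg_dominated th a b y; rewrite S0 !mulr0 normr_le0 => /eqP ->.
by [].
Qed.

Let A y th a b := sample_avg th a b (centred phi y).
Let Q y th a b := sample_avg th a b (centred (fun=> 1) y).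

(** Divided by the evidence, the denominator is 1 + Q and the numerator is A plus the posterior
    mean. The right side is linear in the sample averages, which is what the antithetic halves
    exploit. *)
Lemma ratio_avg_linear y th a b : (a < b)%N -> 0 < ev y ->
  (ratio_avg phi y th a b - posterior_mean phi y) * (1 + Q y th a b) =
  A y th a b - posterior_mean phi y * Q y th a b.
Proof.
move=> ab e0; rewrite /A sample_avg_centred// -ratio_avgM -mulrA sample_avg_lik//.
by rewrite /Q; ring.
Qed.

(** With g the estimator and G its target, the linear identity reads g - G = A - gQ; as g is bounded
    by [B], no lower bound on the random denominator is involved. *)
Lemma ratio_avg_dist y th a b : (a < b)%N -> 0 < ev y ->
  `|ratio_avg phi y th a b - posterior_mean phi y| <= `|A y th a b| + B * `|Q y th a b|.
Proof.
move=> ab e0; have lin := ratio_avg_linear th ab e0.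
have -> : ratio_avg phi y th a b - posterior_mean phi y =
    A y th a b - ratio_avg phi y th a b * Q y th a b.
  by move: lin; lra.
apply: (le_trans (ler_normB _ _)); rewrite lerD2l normrM ler_wpM2r//.
exact: ratio_avg_bound.
Qed.

Lemma ratio_avg_halves y th n : (0 < n)%N -> 0 < ev y ->
  (ratio_avg phi y th 0 (n + n) - posterior_mean phi y) * (1 + Q y th 0 (n + n)) =
  2^-1 * ((ratio_avg phi y th 0 n - posterior_mean phi y) * (1 + Q y th 0 n) +
    (ratio_avg phi y th n (n + n) - posterior_mean phi y) * (1 + Q y th n (n + n))).
Proof.
move=> n0 e0; have nn : (n < n + n)%N by rewrite -[X in (X < _)%N]addn0 ltn_add2l.
rewrite !ratio_avg_linear ?(ltn_trans n0 nn)//.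
by rewrite /A /Q (sample_avg_halves th n (centred phi y))
  (sample_avg_halves th n (centred (fun=> 1) y)); lra.
Qed.

End sample_averages.

(** * Pointwise bound on the correction variable *)

Section decisions.
Context {R : realType} {s k : nat} {D : finType}.
Variables (d0 : D) (prior : probability 'rV[R]_s R) (rho : 'rV[R]_k -> R)
  (h : 'rV[R]_s -> 'rV[R]_k) (f : D -> 'rV[R]_s -> R).
Hypotheses (rho0 : forall x, 0 <= rho x)
  (mrho : measurable_fun setT rho) (mh : measurable_fun setT h)
  (mf : forall d, measurable_fun setT (f d)).

Local Notation ev := (evidence prior rho h).

Lemma Gd_opt y d : 0 < ev y ->
  Gd prior rho h f d y <= Gd prior rho h f (d_opt d0 prior rho h f y) y.
Proof.
move=> e0; rewrite /Gd ler_wpM2r ?invr_ge0 ?(ltW e0)//.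
by rewrite /d_opt; case: arg_maxP => //= i _ ; apply.
Qed.

Lemma decision_gap_le y d : 0 < ev y -> d != d_opt d0 prior rho h f y ->
  (decision_gap d0 prior rho h f y <=
   (Gd prior rho h f (d_opt d0 prior rho h f y) y - Gd prior rho h f d y)%:E)%E.
Proof.
move=> e0 dd; rewrite /decision_gap.
rewrite (max_over_argmax d0 (fun d => Gd_opt d e0)).
rewrite EFinB leeB//; exact: (le_bigmax_cond _ (fun d => (Gd prior rho h f d y)%:E) dd).
Qed.

Lemma dist_to_self (N : 'rV[R]_k -> R) (K : set 'rV[R]_k) y :
  is_norm N -> K y -> (dist_to N K y <= 0)%E.
Proof.
move=> N_norm Ky; apply: ereal_inf_lbound; exists y => //.
by rewrite subrr (is_norm0 N_norm).
Qed.

(** A point farther than [r] from K is not in K, and [r < 1] lets the cap [c1] be weakened to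
    [c1 * r]. *)
Lemma decision_gap_far (N : 'rV[R]_k -> R) (c1 c2 r : R) y d :
  is_norm N -> 0 < c1 -> 0 < c2 -> 0 < r < 1 -> 0 < ev y ->
  (forall y, Y_domain prior rho h y -> ~ decision_manifold prior rho h f y ->
     (mine c1%:E (c2%:E * dist_to N (decision_manifold prior rho h f) y)
          < decision_gap d0 prior rho h f y)%E) ->
  ~ (dist_to N (decision_manifold prior rho h f) y <= r%:E)%E ->
  d != d_opt d0 prior rho h f y ->
  Num.min c1 c2 * r <=
  Gd prior rho h f (d_opt d0 prior rho h f y) y - Gd prior rho h f d y.
Proof.
move=> N_norm c10 c20 /andP[r0 r1] e0 hgap far dd.
have nK : ~ decision_manifold prior rho h f y.
  move=> /(dist_to_self N_norm) h0; apply: far; apply: (le_trans h0).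
  by rewrite lee_fin ltW.
rewrite -lee_fin; apply: le_trans (decision_gap_le e0 dd).
apply: ltW; apply: le_lt_trans (hgap y e0 nK).
move/negP: far; rewrite -ltNge => far.
rewrite le_min; apply/andP; split.
  rewrite lee_fin; apply: (@le_trans _ _ (c1 * r)).
    by rewrite ler_wpM2r ?(ltW r0)// ge_min lexx.
  by rewrite ler_piMr// ltW.
apply: (@le_trans _ _ (c2 * r)%:E).
  by rewrite lee_fin ler_wpM2r ?(ltW r0)// ge_min lexx orbT.
by rewrite EFinM lee_wpmul2l ?lee_fin ?(ltW c20)// ltW.
Qed.

(* [None] encodes the denominator: its centred average is the [q] of
   [antithetic_mean_le]. *)
Definition stat_fun (i : option (option D)) (t : 'rV[R]_s) : R :=
  match i with
  | None => 1
  | Some None => max_over d0 (f ^~ t)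
  | Some (Some d) => f d t
  end.

(* The full sample and its two antithetic halves. *)
Definition block (n : nat) (b : option bool) : nat * nat :=
  match b with
  | None => (0, n + n)
  | Some false => (0, n)
  | Some true => (n, n + n)
  end%N.

Lemma block_lt n b : (0 < n)%N -> ((block n b).1 < (block n b).2)%N.
Proof.
by case: b => [[|]|] n0 //=; rewrite ?addn_gt0 ?n0// -[X in (X < _)%N]addn0 ltn_add2l.
Qed.

Definition block_err (n : nat) (y : 'rV[R]_k) (th : nat -> 'rV[R]_s)
    (j : option bool * option (option D)) : R :=
  sample_avg th (block n j.1).1 (block n j.1).2
    (centred prior rho h (stat_fun j.2) y).

(** One quantity dominating every centred average over the three blocks, so that the pointwise
    argument has a single error e. *)
Definition total_err n y th : R := \sum_j `|block_err n y th j|.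

Lemma measurable_stat_fun i : measurable_fun setT (stat_fun i).
Proof.
case: i => [[d|]|]; [exact: mf|exact: (measurable_max_over d0 mf)|].
exact: measurable_cst.
Qed.

(** [F + 1] serves both the functions bounded by [F] and the constant 1. *)
Lemma stat_fun_bound F : (forall d t, `|f d t| <= F) ->
  forall i t, `|stat_fun i t| <= F + 1.
Proof.
move=> fF; have F0 : 0 <= F by exact: le_trans (fF d0 0).
move=> [[d|]|] t /=.
- by rewrite (le_trans (fF d t))// lerDl.
- have := @max_over_dist _ _ d0 (f ^~ t) (fun=> 0) F.
  rewrite [X in _ - X](@max_over_argmax _ _ d0 _ d0)// subr0 => h1.
  by rewrite (le_trans (h1 _)) ?lerDl// => d; rewrite subr0.
- by rewrite normr1 lerDr.
Qed.

Lemma total_err_ge0 n y th : 0 <= total_err n y th.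
Proof. exact: sumr_ge0. Qed.

Lemma block_err_le n y th j : `|block_err n y th j| <= total_err n y th.
Proof.
by rewrite /total_err (bigD1 j)//= lerDl sumr_ge0.
Qed.

Variables (F : R) (N : 'rV[R]_k -> R) (c1 c2 : R).
Hypotheses (fF : forall d t, `|f d t| <= F) (N_norm : is_norm N)
  (c10 : 0 < c1) (c20 : 0 < c2).
Hypothesis hgap : forall y, Y_domain prior rho h y ->
  ~ decision_manifold prior rho h f y ->
  (mine c1%:E (c2%:E * dist_to N (decision_manifold prior rho h f) y)
     < decision_gap d0 prior rho h f y)%E.

Let B := F + 1.
Let F0 : 0 <= F. Proof. exact: le_trans (fF d0 0). Qed.

(** With B = F + 1, the factor 12(F + 2) covers 8(F + 2) from the quadratic case and 6F + 8 from the
    linear one. The divisor 2(F + 2) comes from a gap of at most 2m <= 2(F + 2)e. *)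
Lemma DeltaP_pointwise M0 l y th (r : R) : (0 < M0)%N -> (0 < l)%N ->
  0 < ev y -> 0 < r < 1 ->
  let e := total_err (level_size M0 l.-1) y th in
  `|DeltaP d0 rho h f M0 l y th| <= (12 * (F + 2)) * (e * Num.min 1 e) \/
  (`|DeltaP d0 rho h f M0 l y th| <= (12 * (F + 2)) * e /\
   (`[< (dist_to N (decision_manifold prior rho h f) y <= r%:E)%E >] \/
    Num.min c1 c2 / (2 * (F + 2)) * r <= e)).
Proof.
move=> M00 l0 e0 r01 e.
set n := level_size M0 l.-1 in e *.
have n0 : (0 < n)%N by rewrite muln_gt0 M00 expn_gt0.
have nn : level_size M0 l = (n + n)%N.
  by rewrite /n /level_size -{1}(prednK l0) expnS mulnCA mul2n addnn.
have Bi := stat_fun_bound fF.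
pose G i := posterior_mean prior rho h (stat_fun i) y.
pose g b i := ratio_avg rho h (stat_fun i) y th (block n b).1 (block n b).2.
pose q b := sample_avg th (block n b).1 (block n b).2
  (centred prior rho h (fun=> 1) y).
have e_ge0 : 0 <= e by exact: total_err_ge0.
have qe b : `|q b| <= e by exact: (block_err_le n y th (b, None)).
have Ae b i : `|sample_avg th (block n b).1 (block n b).2
    (centred prior rho h (stat_fun i) y)| <= e.
  exact: (block_err_le n y th (b, i)).
(* The first bound holds because estimators and posterior means are bounded by [B]; it turns e^2
   into e min(1, e). *)
pose m := Num.min (2 * B) ((1 + B) * e).
have B1 : 1 <= B by rewrite lerDr.
have gm b i : `|g b i - G i| <= m.
  rewrite le_min; apply/andP; split.
    rewrite (le_trans (ler_normB _ _))// mulr_natl mulr2n lerD//.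
      by apply: ratio_avg_bound => //; exact: Bi.
    exact: (posterior_mean_bound prior rho0 mrho mh (measurable_stat_fun i) (Bi i) y).
  have := ratio_avg_dist (prior := prior) rho0 (Bi i) th (block_lt b n0) e0.
  move=> /le_trans; apply; rewrite [leRHS]mulrDl mul1r lerD//.
  by apply: ler_wpM2l; [exact: (le_trans ler01 B1)|exact: qe].
have lin i : (g None i - G i) * (1 + q None) =
    2^-1 * ((g (Some false) i - G i) * (1 + q (Some false)) +
            (g (Some true) i - G i) * (1 + q (Some true))).
  exact: (ratio_avg_halves (prior := prior) rho0 (Bi i) th n0 e0).
have Gdi d : G (Some (Some d)) = Gd prior rho h f d y by [].
have m_le : m <= 2 * (1 + B) * Num.min 1 e.
  have [e1|e1] := leP 1 e.
    by rewrite mulr1 ge_min; apply/orP; left; lra.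
  by rewrite ge_min; apply/orP; right; rewrite ler_wpM2r//; lra.
have m_le2 : m <= (1 + B) * e by rewrite ge_min lexx orbT.
have m_le3 : m <= 2 * B by rewrite ge_min lexx.
have mmin0 : 0 <= Num.min 1 e by rewrite le_min ler01 e_ge0.
have BF : 1 + B = F + 2 by rewrite /B; lra.
have me : m * e <= 2 * (1 + B) * (e * Num.min 1 e).
  by rewrite [e * _]mulrC mulrA ler_wpM2r.
have := @antithetic_max_le _ _ d0 (d_opt d0 prior rho h f y)
  (fun d => G (Some (Some d))) (fun d => g None (Some (Some d)))
  (fun d => g (Some false) (Some (Some d))) (fun d => g (Some true) (Some (Some d)))
  (G (Some None)) (g None (Some None)) (g (Some false) (Some None))
  (g (Some true) (Some None)) (q None) (q (Some false)) (q (Some true)) m e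
  (fun d => lin _) (lin _) (fun d => gm _ _) (fun d => gm _ _) (fun d => gm _ _)
  (gm _ _) (gm _ _) (gm _ _) (qe _) (qe _) (qe _).
rewrite -/(DeltaP _ _ _ _ _ _ _ _) /=.
have -> : g None (Some None) - max_over d0 (fun d => g None (Some (Some d))) -
   2^-1 * (g (Some false) (Some None) + g (Some true) (Some None)) +
   2^-1 * (max_over d0 (fun d => g (Some false) (Some (Some d))) +
     max_over d0 (fun d => g (Some true) (Some (Some d)))) =
   DeltaP d0 rho h f M0 l y th.
  by rewrite /DeltaP nn.
have emin0 : 0 <= e * Num.min 1 e by exact: mulr_ge0.
case=> [De|[De [d dd Gd2]]].
  left; apply: (le_trans De); rewrite BF in me.
  have : 0 <= F * (e * Num.min 1 e) by rewrite mulr_ge0.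
  lra.
right; split.
  apply: (le_trans De).
  have : m * e <= 2 * B * e by rewrite ler_wpM2r.
  have : 0 <= F * e by rewrite mulr_ge0.
  rewrite /B in m_le2 *; lra.
have [near|far] := pselect (dist_to N (decision_manifold prior rho h f) y <= r%:E)%E.
  by left; apply/asboolP.
right; have h1 := decision_gap_far N_norm c10 c20 r01 e0 hgap far dd.
rewrite mulrAC ler_pdivrMr; last by rewrite mulr_gt0// ltr_wpDl.
rewrite !Gdi in Gd2.
have := le_trans h1 Gd2; rewrite BF in m_le2; lra.
Qed.

End decisions.

(** * Bounds at a given level *)

Lemma variance_le_sqr d (Om : measurableType d) (R : realType)
    (P : probability Om R) (X : Om -> R) :
  measurable_fun setT X -> (\int[P]_w (`|X w| `^ 2)%:E < +oo)%E ->
  ('V_P[X] <= \int[P]_w (`|X w| `^ 2)%:E)%E.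
Proof.
move=> mX X2.
have X2L : X \in Lfun P 2%:E.
  rewrite inE; apply/andP; split; first by rewrite inE.
  rewrite inE /= /finite_norm unlock /Lnorm.
  by rewrite poweR_lty// (_ : (\int[P]_w _)%E = (\int[P]_w (`|X w| `^ 2)%:E)%E).
have EX : 'E_P[X]%E \is a fin_num.
  by apply: expectation_fin_num; apply: Lfun_subset12 => //; exact: fin_num_measure.
rewrite varianceE// [X in (X - _)%E](_ : _ = (\int[P]_w (`|X w| `^ 2)%:E)%E).
  by rewrite leeBlDr ?fin_numX// leeDl// -(fineK EX) -EFin_expe lee_fin sqr_ge0.
rewrite unlock; apply: eq_integral => w _.
by rewrite powR_mulrn// real_normK ?num_real.
Qed.

Lemma measurable_sample_avg d (Om : measurableType d) (R : realType) s k
    (Y : Om -> 'rV[R]_k) (th : nat -> Om -> 'rV[R]_s)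
    (psi : 'rV[R]_k -> 'rV[R]_s -> R) a b :
  measurable_fun setT Y -> (forall m, measurable_fun setT (th m)) ->
  measurable_fun setT (fun yt : 'rV[R]_k * 'rV[R]_s => psi yt.1 yt.2) ->
  measurable_fun setT (fun w => sample_avg (th ^~ w) a b (psi (Y w))).
Proof.
move=> mY mth mpsi; apply: measurable_funM => //.
by apply: measurable_sum => m; apply: (measurable_fun_comp2 (phi := psi)).
Qed.

Section one_level.
Context {R : realType} {s k : nat} {D : finType} (d : measure_display)
  (Om : measurableType d) (P : probability Om R).
Variables (d0 : D) (prior : probability 'rV[R]_s R) (rho : 'rV[R]_k -> R)
  (h : 'rV[R]_s -> 'rV[R]_k) (f : D -> 'rV[R]_s -> R) (F p : R).
Hypotheses (rho0 : forall x, 0 <= rho x)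
  (mrho : measurable_fun setT rho) (mh : measurable_fun setT h)
  (mf : forall d, measurable_fun setT (f d))
  (fF : forall d t, `|f d t| <= F) (p2 : 2 <= p).
Variables (Y : {RV P >-> 'rV[R]_k}) (th : nat -> {RV P >-> 'rV[R]_s}).

Local Notation lik := (likelihood rho h).
Local Notation ev := (evidence prior rho h).

Lemma measurable_DeltaP M0 l :
  measurable_fun setT (fun w => DeltaP d0 rho h f M0 l (Y w) (th ^~ w)).
Proof.
have mavg (phi : 'rV[R]_s -> R) a b : measurable_fun setT phi ->
    measurable_fun setT (fun w => ratio_avg rho h phi (Y w) (th ^~ w) a b).
  move=> mphi; apply: measurable_funM.
    apply: (measurable_sample_avg (psi := fun y t => phi t * lik y t)) => //.
    apply: measurable_funM; last exact: measurable_likelihood.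
    exact: measurableT_comp.
  apply: (measurableT_comp (@measurable_invr R)).
  by apply: (measurable_sample_avg (psi := lik)) => //; exact: measurable_likelihood.
have mmax a b : measurable_fun setT
    (fun w => max_over d0 (g_avg rho h f (Y w) (th ^~ w) a b)).
  apply: (measurable_max_over d0
    (x := fun d w => ratio_avg rho h (f d) (Y w) (th ^~ w) a b)) => d1.
  exact: mavg.
have mgmax a b : measurable_fun setT
    (fun w => g_max_avg d0 rho h f (Y w) (th ^~ w) a b).
  apply: (mavg (fun t => max_over d0 (f ^~ t))); exact: measurable_max_over.
apply: measurable_funD; last by apply: measurable_funM => //; apply: measurable_funD.
apply: measurable_funB; first by apply: measurable_funB.
by apply: measurable_funM => //; apply: measurable_funD.
Qed.

Lemma measurable_block_err n j : measurable_fun setT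
  (fun w => block_err d0 prior rho h f n (Y w) (th ^~ w) j).
Proof.
apply: (measurable_sample_avg
  (psi := centred prior rho h (stat_fun d0 f j.2))) => //.
apply: measurable_centred => //; exact: measurable_stat_fun.
Qed.

Lemma measurable_total_err n : measurable_fun setT
  (fun w => total_err d0 prior rho h f n (Y w) (th ^~ w)).
Proof.
apply: measurable_sum => j; apply: measurableT_comp => //.
exact: measurable_block_err.
Qed.

Variables (n : nat) (I : R).
Hypotheses (n0 : (0 < n)%N) (indep : indep_draws P Y (n + n) th)
  (law_th : forall m A, (m < n + n)%N -> measurable A ->
    distribution P (th m) A = prior A)
  (IE : (\int[distribution P Y]_y \int[prior]_t ((lik y t / ev y) `^ p)%:E <= I%:E)%E).

Let M : R := (n + n)%:R.

(** The factors come from half blocks, whose size is M/2, from the Marcinkiewicz-Zygmund inequality,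
    and from [centred_moment] with bound [F + 1]. *)
Definition err_cst : R :=
  2 `^ (p / 2) * (expR 1 * MZ_cst p) * ((2 * (F + 1)) `^ p * (I + 1)).

Lemma block_err_moment j :
  (\int[P]_w (`|block_err d0 prior rho h f n (Y w) (th ^~ w) j| `^ p)%:E <=
   (err_cst * M `^ (- (p / 2)))%:E)%E.
Proof.
have Bi := stat_fun_bound d0 fF j.2.
have mphi := measurable_stat_fun d0 mf j.2.
set a := (block n j.1).1; set b := (block n j.1).2.
have ab : (a < b)%N by exact: block_lt.
have bn : (b <= n + n)%N by rewrite /b; case: (j.1) => [[|]|] //=; exact: leq_addr.
have nab : (n <= b - a)%N.
  by rewrite /a /b; case: (j.1) => [[|]|] /=; rewrite ?addnK ?subn0 ?leq_addr.
pose phi := centred prior rho h (stat_fun d0 f j.2).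
have mphi' : measurable_fun setT (fun yt : 'rV[R]_k * 'rV[R]_s => phi yt.1 yt.2).
  exact: measurable_centred.
have cen y := integrable_centred prior rho0 mrho mh mphi Bi y.
have := marcinkiewicz_zygmund indep law_th mphi' (fun y => (cen y).1)
  (fun y => (cen y).2) p2 (a := a) (b := b).
rewrite (ltnW ab) bn => /(_ isT) mz.
have p0 : 0 < p by move: p2; lra.
set c : R := (b - a)%:R.
have c0 : 0 < c by rewrite ltr0n subn_gt0.
have n0R : 0 < n%:R :> R by rewrite ltr0n.
have -> : (\int[P]_w (`|block_err d0 prior rho h f n (Y w) (th ^~ w) j| `^ p)%:E =
    \int[P]_w ((c `^ (- p))%:E * (`|\sum_(a <= m < b) phi (Y w) (th m w)| `^ p)%:E))%E.
  apply: eq_integral => w _; rewrite -EFinM; congr (_%:E).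
  rewrite /block_err /sample_avg -/a -/b normrM powRM//; congr (_ * _).
  by rewrite ger0_norm ?invr_ge0// -/c -powR_inv1 ?(ltW c0)// -powRrM mulN1r.
rewrite ge0_integralZl//; last 2 first.
- apply/measurable_EFinP; apply: (measurableT_comp (measurable_powR _)).
  apply: measurableT_comp => //; apply: measurable_sum => m.
  exact: (measurable_fun_comp2 (phi := phi)).
- by rewrite lee_fin powR_ge0.
have mom := centred_moment prior rho0 mrho mh mphi Bi Y p0.
have K0 : 0 <= expR 1 * MZ_cst p * c `^ (p / 2).
  by rewrite !mulr_ge0 ?expR_ge0 ?powR_ge0// ltW// MZ_cst_gt0//; move: p2; lra.
have B0 : 0 <= (2 * (F + 1)) `^ p by exact: powR_ge0.
apply: (@le_trans _ _ ((c `^ (- p))%:E * ((expR 1 * MZ_cst p * c `^ (p / 2))%:E *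
    (((2 * (F + 1)) `^ p)%:E * (I%:E + 1))))%E).
  apply: lee_wpmul2l; first by rewrite lee_fin powR_ge0.
  apply: (le_trans mz); apply: lee_wpmul2l; first by rewrite lee_fin.
  apply: (le_trans mom); apply: lee_wpmul2l; first by rewrite lee_fin.
  by apply: leeD.
rewrite -EFinD -!EFinM lee_fin /err_cst.
have I0 : 0 <= I.
  rewrite -lee_fin; apply: le_trans IE; do 2 apply: integral_ge0 => ? _.
  by rewrite lee_fin powR_ge0.
have -> : c `^ (- p) * (expR 1 * MZ_cst p * c `^ (p / 2) *
    ((2 * (F + 1)) `^ p * (I + 1))) =
  (expR 1 * MZ_cst p) * ((2 * (F + 1)) `^ p * (I + 1)) * c `^ (- (p / 2)).
  have -> : c `^ (- (p / 2)) = c `^ (- p) * c `^ (p / 2).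
    by rewrite -powRD ?(gt_eqF c0) ?implybT//; congr (_ `^ _); lra.
  ring.
have cM : c `^ (- (p / 2)) <= 2 `^ (p / 2) * M `^ (- (p / 2)).
  apply: (@le_trans _ _ ((M / 2) `^ (- (p / 2)))).
    apply: le0_powR_le; first by move: p2; lra.
      by rewrite divr_gt0// ltr0n addn_gt0 n0.
    rewrite /M natrD ler_pdivrMr//.
    have : n%:R <= c by rewrite ler_nat.
    lra.
  rewrite powRM ?invr_ge0// mulrC -(powR_inv1 (ltW _))//.
  by rewrite -powRrM mulrNN mul1r.
have L0 : 0 <= (expR 1 * MZ_cst p) * ((2 * (F + 1)) `^ p * (I + 1)).
  have C0 : 0 <= MZ_cst p by apply/ltW/MZ_cst_gt0; move: p2; lra.
  have E0 : 0 <= expR 1 :> R by exact: expR_ge0.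
  have I1 : 0 <= I + 1 by exact: addr_ge0.
  by apply: mulr_ge0; apply: mulr_ge0.
apply: (le_trans (ler_wpM2l L0 cM)).
by rewrite le_eqVlt; apply/orP; left; apply/eqP; ring.
Qed.

Definition total_err_cst : R :=
  #|{: option bool * option (option D)}|%:R `^ p *
  (#|{: option bool * option (option D)}|%:R * err_cst).

Lemma total_err_moment :
  (\int[P]_w (M `^ (p / 2) *
     total_err d0 prior rho h f n (Y w) (th ^~ w) `^ p)%:E <= total_err_cst%:E)%E.
Proof.
have p0 : 0 < p by move: p2; lra.
have M_gt0 : 0 < M by rewrite ltr0n addn_gt0 n0.
pose J : R := #|{: option bool * option (option D)}|%:R `^ p.
have J0 : 0 <= J by exact: powR_ge0.
pose X j w := (`|block_err d0 prior rho h f n (Y w) (th ^~ w) j| `^ p)%:E.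
have mX j : measurable_fun setT (X j).
  apply/measurable_EFinP; apply: (measurableT_comp (measurable_powR _)).
  by apply: measurableT_comp => //; exact: measurable_block_err.
have X0 j w : (0 <= X j w)%E by rewrite lee_fin powR_ge0.
have mS : measurable_fun setT (fun w => \sum_j X j w)%E.
  by apply: emeasurable_sum => j; exact: mX.
apply: (@le_trans _ _ (\int[P]_w ((M `^ (p / 2) * J)%:E * \sum_j X j w))%E).
  apply: ge0_le_integral => //.
  - by move=> w _; rewrite lee_fin mulr_ge0 ?powR_ge0.
  - apply/measurable_EFinP; apply: measurable_funM => //.
    apply: (measurableT_comp (measurable_powR _)); exact: measurable_total_err.
  - exact: measurable_funeM.
  - move=> w _; rewrite sumEFin -EFinM lee_fin -mulrA ler_wpM2l ?powR_ge0//.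
    exact: powR_sum_le.
rewrite ge0_integralZl//; last 2 first.
- by move=> w _; apply: sume_ge0.
- by rewrite lee_fin mulr_ge0 ?powR_ge0.
rewrite ge0_integral_sum//.
apply: (@le_trans _ _ ((M `^ (p / 2) * J)%:E *
  \sum_(j : option bool * option (option D)) (err_cst * M `^ (- (p / 2)))%:E)%E).
  apply: lee_wpmul2l; first by rewrite lee_fin mulr_ge0 ?powR_ge0.
  by apply: lee_sum => j _; exact: block_err_moment.
rewrite sumEFin -EFinM lee_fin sumr_const -[X in _ * X <= _]mulr_natr.
rewrite le_eqVlt; apply/orP; left; apply/eqP.
rewrite /total_err_cst -/J.
have := powRD (x := M) (r := p / 2) (s := - (p / 2)).
rewrite (gt_eqF M_gt0) implybT subrr powRr0 => /(_ isT) E.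
by transitivity (J * (#|{: option bool * option (option D)}|%:R * err_cst) *
  (M `^ (p / 2) * M `^ (- (p / 2)))); [ring|rewrite -E mulr1].
Qed.

End one_level.

Section level_bound.
Context {R : realType} {s k : nat} {D : finType} (d : measure_display)
  (Om : measurableType d) (P : probability Om R).
Variables (d0 : D) (prior : probability 'rV[R]_s R) (rho : 'rV[R]_k -> R)
  (h : 'rV[R]_s -> 'rV[R]_k) (f : D -> 'rV[R]_s -> R) (F p : R).
Hypotheses (rho0 : forall x, 0 <= rho x)
  (mrho : measurable_fun setT rho) (mh : measurable_fun setT h)
  (mf : forall d, measurable_fun setT (f d))
  (fF : forall d t, `|f d t| <= F) (p2 : 2 <= p).
Variables (Y : {RV P >-> 'rV[R]_k}) (th : nat -> {RV P >-> 'rV[R]_s}).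

Local Notation ev := (evidence prior rho h).
Local Notation K := (decision_manifold prior rho h f).

Variables (N : 'rV[R]_k -> R) (c0 c1 c2 : R).
Hypotheses (N_norm : is_norm N) (c10 : 0 < c1) (c20 : 0 < c2).
Hypothesis hgap : forall y, Y_domain prior rho h y -> ~ K y ->
  (mine c1%:E (c2%:E * dist_to N K y) < decision_gap d0 prior rho h f y)%E.
Hypothesis hnear : forall r : R, 0 < r < 1 ->
  (distribution P Y [set y | dist_to N K y <= r%:E] <= (c0 * r)%:E)%E.
Hypothesis evidence_pos : distribution P Y (~` Y_domain prior rho h) = 0%E.

Definition gap_cst : R := Num.min c1 c2 / (2 * (F + 2)).

(** The last factor bounds the expectation of 1 + u^p + 1{dist(Y,K) <= r} / r term by term. *)
Definition level_cst (q I : R) : R :=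
  (12 * (F + 2)) `^ q * (1 + gap_cst `^ (q - p)) *
  (1 + total_err_cst (D := D) F p I + c0).

Lemma level_bound M0 l (q I : R) : (0 < M0)%N -> (0 < l)%N ->
  1 <= q -> q <= p ->
  indep_draws P Y (level_size M0 l) th ->
  (forall m A, (m < level_size M0 l)%N -> measurable A ->
    distribution P (th m) A = prior A) ->
  (\int[distribution P Y]_y \int[prior]_t
    ((likelihood rho h y t / ev y) `^ p)%:E <= I%:E)%E ->
  (\int[P]_w (`|DeltaP d0 rho h f M0 l (Y w) (th ^~ w)| `^ q)%:E <=
   (level_cst q I * (level_size M0 l)%:R `^ (- (p * (q + 1) / (2 * (p + 1)))))%:E)%E.
Proof.
move=> M00 l0 q1 qp indep law_th IE.
set n := level_size M0 l.-1.
have n0 : (0 < n)%N by rewrite muln_gt0 M00 expn_gt0.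
have nn : level_size M0 l = (n + n)%N.
  by rewrite /n /level_size -{1}(prednK l0) expnS mulnCA mul2n addnn.
rewrite nn in indep law_th *.
set M : R := (n + n)%:R.
have M1 : 1 < M by rewrite ltr1n -addn1 leq_add.
have M0' : 0 < M by exact: lt_trans M1.
set kappa := _ / _.
pose r := M `^ (- (p / (2 * p + 2))).
have r0 : 0 < r by exact: powR_gt0.
(* The assumption on the mass near K covers only radii below 1. *)
have r1 : r < 1.
  rewrite /r powRN invf_lt1 ?powR_gt0// -[ltLHS](@powRr0 _ M).
  rewrite /powR gt_eqF// ltr_expR ltr_pM2r ?ln_gt0//.
  by rewrite divr_gt0//; move: p2; lra.
have F0 : 0 <= F by exact: le_trans (fF d0 0).
have A0 : 0 < 12 * (F + 2) by lra.
have g0 : 0 < gap_cst by rewrite divr_gt0 ?lt_min ?c10//; lra.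
pose S := [set y | (dist_to N K y <= r%:E)%E].
have mS : measurable S by exact: measurable_dist_to_le.
pose e w := total_err d0 prior rho h f n (Y w) (th ^~ w).
have me : measurable_fun setT e by exact: measurable_total_err.
pose U w : R := M `^ (p / 2) * e w `^ p.
have mU : measurable_fun setT U.
  by apply: measurable_funM => //; apply: (measurableT_comp (measurable_powR _)).
have U0 w : 0 <= U w by rewrite mulr_ge0 ?powR_ge0.
have mYS : measurable (Y @^-1` S) by exact: measurable_funPTI.
pose V w : R := \1_(Y @^-1` S) w * r^-1.
have mV : measurable_fun setT V.
  by apply: measurable_funM => //; exact: measurable_indic.
have V0 w : 0 <= V w by rewrite mulr_ge0 ?invr_ge0 ?(ltW r0).
pose C := (12 * (F + 2)) `^ q * (1 + gap_cst `^ (q - p)) * M `^ (- kappa).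
have C0 : 0 <= C by rewrite !mulr_ge0 ?addr_ge0 ?powR_ge0.
have mDP := @measurable_DeltaP R s k D d Om P d0 rho h f mrho mh mf Y th M0 l.
apply: (@le_trans _ _ (\int[P]_w (C%:E * (1 + (U w)%:E + (V w)%:E)))%E).
  apply: ae_ge0_le_integral => //.
  - apply/measurable_EFinP; apply: (measurableT_comp (measurable_powR _)).
    exact: measurableT_comp.
  - by move=> w _; rewrite -!EFinD -EFinM lee_fin mulr_ge0// !addr_ge0.
  - apply/measurable_EFinP; apply: measurable_funM => //.
    by apply: measurable_funD => //; apply: measurable_funD.
  (* The pointwise bound holds where the evidence is positive; the other outcomes form this null
     event. *)
  exists (Y @^-1` (~` Y_domain prior rho h)); split.
  - apply: measurable_funPTI; apply: measurableC.
    exact: measurable_Y_domain.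
  - exact: evidence_pos.
  move=> w /= nw evw; apply: nw => _.
  rewrite -!EFinD -EFinM lee_fin.
  have h1 := DeltaP_pointwise rho0 mrho mh mf fF N_norm c10 c20 hgap (th ^~ w)
    M00 l0 evw (r := r).
  rewrite r0 r1 in h1; have {}h1 := h1 isT.
  have h2 := pointwise_rate p2 q1 qp M1 (total_err_ge0 _ _ _ _ _ _ _ _) A0 g0 h1.
  apply: (le_trans h2); rewrite -/kappa -/C.
  suff -> : V w = `[< (dist_to N K (Y w) <= r%:E)%E >]%:R * r^-1 by [].
  by rewrite /V indicE; congr (_%:R * _).
have mUe : measurable_fun setT (fun w => (U w)%:E) by exact/measurable_EFinP.
have mVe : measurable_fun setT (fun w => (V w)%:E) by exact/measurable_EFinP.
have U0e w : (0 <= (U w)%:E)%E by rewrite lee_fin.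
have V0e w : (0 <= (V w)%:E)%E by rewrite lee_fin.
have m1U : measurable_fun setT (fun w => 1 + (U w)%:E)%E by exact: emeasurable_funD.
have U1e w : (0 <= 1 + (U w)%:E)%E by exact: adde_ge0.
rewrite ge0_integralZl//; [|exact: emeasurable_funD|by move=> w _; exact: adde_ge0].
rewrite ge0_integralD// ge0_integralD//.
rewrite integral_cst// [X in (1 * X)%E]probability_setT mul1e.
have EU : (\int[P]_w (U w)%:E <= (total_err_cst (D := D) F p I)%:E)%E.
  exact: (total_err_moment d0 rho0 mrho mh mf fF p2 n0 indep law_th IE).
have EV : (\int[P]_w (V w)%:E <= c0%:E)%E.
  rewrite /V; under eq_integral do rewrite EFinM.
  rewrite ge0_integralZr//; last 2 first.
  - by apply/measurable_EFinP; exact: measurable_indic.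
  - by rewrite lee_fin invr_ge0 ltW.
  rewrite integral_indic// setIT.
  apply: (@le_trans _ _ ((c0 * r)%:E * (r^-1)%:E)%E).
    apply: lee_wpmul2r; first by rewrite lee_fin invr_ge0 ltW.
    by apply: hnear; rewrite r0 r1.
  by rewrite -EFinM mulfK// gt_eqF.
apply: (@le_trans _ _ (C%:E * (1%:E + (total_err_cst (D := D) F p I)%:E + c0%:E))%E).
  apply: lee_wpmul2l; first by rewrite lee_fin.
  by apply: leeD => //; apply: leeD.
rewrite -!EFinD -EFinM lee_fin /C /level_cst le_eqVlt; apply/orP; left; apply/eqP.
by ring.
Qed.

End level_bound.

Theorem theorem3p6 (R : realType) (s k : nat) (disp : measure_display)
  (Omega : measurableType disp) (P : probability Omega R)
  (* the model: theta ~ pi0, eps ~ rho, independent, Y = h(theta) + eps *)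
  (theta : {RV P >-> 'rV[R]_s}) (eps Y : {RV P >-> 'rV[R]_k})
  (pi0 : 'rV[R]_s -> R) (rho : 'rV[R]_k -> R) (h : 'rV[R]_s -> 'rV[R]_k)
  (h_meas : measurable_fun [set: 'rV[R]_s] h)
  (theta_density : has_density (lebesgue_rV R s) (distribution P theta) pi0)
  (eps_density : has_density (lebesgue_rV R k) (distribution P eps) rho)
  (eps_mean : zero_mean P eps)
  (theta_eps_indep : indep_pair P theta eps)
  (Y_def : forall w, Y w = h (theta w) + eps w)
  (* decisions *)
  (D : finType) (d0 : D) (f : D -> 'rV[R]_s -> R)
  (f_meas : forall d, measurable_fun [set: 'rV[R]_s] (f d))
  (* the norm on the space of Y *)
  (N : 'rV[R]_k -> R) (N_norm : is_norm N)
  (* the draws of level l *)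
  (M0 : nat) (M0_gt0 : (0 < M0)%N)
  (Ys : nat -> {RV P >-> 'rV[R]_k}) (thetas : nat -> nat -> {RV P >-> 'rV[R]_s})
  (Ys_law : forall l, (1 <= l)%N -> same_law P (Ys l) Y)
  (thetas_law : forall l m, (1 <= l)%N -> (m < level_size M0 l)%N ->
     same_law P (thetas l m) theta)
  (draws_indep : forall l, (1 <= l)%N ->
     indep_draws P (Ys l) (level_size M0 l) (thetas l)) :
  let prior : probability 'rV[R]_s R := distribution P theta in
  let law_Y : probability 'rV[R]_k R := distribution P Y in
  let K := decision_manifold prior rho h f in
  (* the decision manifold is lower-dimensional *)
  (lebesgue_rV R k).-negligible K ->
  (* boundedness of the f_d *)
  (exists2 Fmax : R, 0 < Fmax & forall d t, `|f d t| <= Fmax) ->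
  (* mass of Y near the decision manifold *)
  (exists2 c0 : R, 0 < c0 & forall r : R, 0 < r < 1 ->
     (law_Y [set y | dist_to N K y <= r%:E] <= (c0 * r)%:E)%E) ->
  (* gap between the best and the second best decision *)
  (exists c1 c2 : R, [/\ 0 < c1, 0 < c2 &
     forall y, Y_domain prior rho h y -> ~ K y ->
       (mine c1%:E (c2%:E * dist_to N K y)
          < decision_gap d0 prior rho h f y)%E]) ->
  (* p-th moment of the likelihood ratio *)
  forall p : R, 2 <= p ->
  (\int[law_Y]_y \int[prior]_t
     ((likelihood rho h y t / evidence prior rho h y) `^ p)%:E < +oo)%E ->
  let dP l w := DeltaP d0 rho h f M0 l (Ys l w) (thetas l ^~ w) in
  (exists C : R, \forall l \near \oo,
     ('V_P[dP l] <= (C * 2 `^ (- (3 * p / (2 * p + 2)) * l%:R))%:E)%E) /\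
  (exists C : R, \forall l \near \oo,
     ('E_P[fun w => `|dP l w|%R] <= (C * 2 `^ (- (p / (p + 1)) * l%:R))%:E)%E).
Proof.
move=> prior law_Y K _ [F F0 fF] [c0 c0_gt0 hnear] [c1 [c2 [c10 c20 hgap]]].
move=> p p2 hI dP.
have [mrho rho0 _] := eps_density.
pose Iv := (\int[law_Y]_y \int[prior]_t
  ((likelihood rho h y t / evidence prior rho h y) `^ p)%:E)%E.
have Iv0 : (0 <= Iv)%E.
  by do 2 apply: integral_ge0 => ? _; rewrite lee_fin powR_ge0.
have IvE : Iv = (fine Iv)%:E by rewrite fineK// ge0_fin_numE.
have evY : law_Y (~` Y_domain prior rho h) = 0%E.
  exact: (evidence_gt0_ae h_meas eps_density theta_eps_indep Y_def).
have mYd : measurable (~` Y_domain prior rho h).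
  by apply: measurableC; exact: measurable_Y_domain.
have mDP l : measurable_fun setT (dP l).
  exact: (measurable_DeltaP d0 mrho h_meas f_meas (Ys l) (thetas l)).
pose kappa q : R := p * (q + 1) / (2 * (p + 1)).
have core q : 1 <= q -> q <= p -> exists C : R, forall l, (1 <= l)%N ->
    (\int[P]_w (`|dP l w| `^ q)%:E <= (C * 2 `^ (- kappa q * l%:R))%:E)%E.
  move=> q1 qp; pose C := level_cst (D := D) F p c0 c1 c2 q (fine Iv).
  (* A nonnegative constant is preserved when the level size is replaced by its lower bound 2^l
     under a nonpositive exponent. *)
  exists `|C| => l l1.
  (* The hypotheses on the observation depend only on its law, which [Ys l] shares with [Y]: hence
     constants uniform in the level. *)
  have evl : distribution P (Ys l) (~` Y_domain prior rho h) = 0%E.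
    by rewrite (Ys_law l l1).
  have hnl r : 0 < r < 1 -> (distribution P (Ys l)
      [set y | dist_to N K y <= r%:E] <= (c0 * r)%:E)%E.
    move=> r01; rewrite (Ys_law l l1); first exact: hnear.
    exact: measurable_dist_to_le.
  have IE : (\int[distribution P (Ys l)]_y \int[prior]_t
      ((likelihood rho h y t / evidence prior rho h y) `^ p)%:E <= (fine Iv)%:E)%E.
    rewrite -IvE le_eqVlt; apply/orP; left; apply/eqP.
    by apply: eq_measure_integral => A mA _; exact: Ys_law.
  have lawl m A : (m < level_size M0 l)%N -> measurable A ->
      distribution P (thetas l m) A = prior A.
    by move=> ml mA; exact: thetas_law.
  have := level_bound rho0 mrho h_meas f_meas fF p2 N_norm c10 c20 hgap hnl evl
    M0_gt0 l1 q1 qp (draws_indep l l1) lawl IE.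
  move=> /le_trans; apply; rewrite lee_fin -/C -/(kappa q).
  have k0 : 0 <= kappa q by rewrite /kappa divr_ge0// mulr_ge0//; lra.
  apply: (@le_trans _ _ (`|C| * (level_size M0 l)%:R `^ (- kappa q))).
    by rewrite ler_wpM2r ?powR_ge0// ler_norm.
  rewrite ler_wpM2l// [_ * l%:R]mulrC powRrM powR_mulrn//.
  apply: le0_powR_le; rewrite ?oppr_le0 ?exprn_gt0//.
  by rewrite -natrX ler_nat /level_size leq_pmull.
split.
  have [C hC] := core 2 ltac:(lra) p2.
  exists C; exists 1%N => // l /= l1.
  have h2 := hC l l1.
  have -> : 3 * p / (2 * p + 2) = kappa 2.
    by rewrite /kappa; congr (_ / _); lra.
  apply: le_trans h2; apply: variance_le_sqr => //.
  by apply: le_lt_trans (hC l l1) _; rewrite ltry.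
have [C hC] := core 1 (lexx _) ltac:(lra).
exists C; exists 1%N => // l /= l1; rewrite unlock.
have -> : p / (p + 1) = kappa 1.
  by rewrite /kappa; field; rewrite gt_eqF//; lra.
apply: le_trans (hC l l1); rewrite le_eqVlt; apply/orP; left; apply/eqP.
by apply: eq_integral => w _; rewrite powRr1.
Qed.
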